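(* Let $\eta\in\mathbb{R}$. There exists a minimiser of $\mathcal{F}$ over $\mathcal{P}(\mathbb{S}^2)$ with finite energy (that is, $f^*\in\mathcal{P}(\mathbb{S}^2)$ with $\mathcal{F}(f^* )<+\infty$ and $\mathcal{F}(f^* )\le\mathcal{F}(f)$ for all $f\in\mathcal{P}(\mathbb{S}^2)$) if and only if $\eta<\frac{2}{3}$.
   Context: $\mathbb{S}^2\subset\mathbb{R}^3$ is the unit sphere and $dp$ is the 2-dimensional Hausdorff measure on it. $\mathcal{P}(\mathbb{S}^2)=\{f\in L^1(\mathbb{S}^2): f\ge 0 \text{ a.e.},\ \int_{\mathbb{S}^2}f\,dp=1\}$. For $\eta\in\mathbb{R}$, the energy $\mathcal{F}:\mathcal{P}(\mathbb{S}^2)\to\mathbb{R}\cup\{+\infty\}$ is $$\mathcal{F}(f)=\int_{\mathbb{S}^2}f(p)\ln f(p)-f(p)\ln\left(\int_{\mathbb{S}^2}\left((p\cdot q)^2-\tfrac13\right)f(q)\,dq-\eta\right)dp,$$ where $-\ln$ is extended by $+\infty$ for non-positive arguments, and the conventions $0\times(+\infty)=0$ and $0\ln 0=0$ are used. *)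

(* Defs.v *)
From HB Require Import structures.
From mathcomp Require Import all_boot all_order all_algebra.
From mathcomp Require Import all_classical all_reals all_analysis.

Set Implicit Arguments.
Unset Strict Implicit.
Unset Printing Implicit Defensive.
Import Order.TTheory GRing.Theory Num.Theory.
Import numFieldNormedType.Exports.
Local Open Scope classical_set_scope.
Local Open Scope ring_scope.

(* The norm that the library puts on 'rV[R]_n is the sup norm, so the
   Euclidean structure is introduced by hand. *)
Definition dot (R : realType) (n : nat) (p q : 'rV[R]_n) : R :=
  \sum_(i < n) p 0 i * q 0 i.

Definition edist (R : realType) (n : nat) (p q : 'rV[R]_n) : R :=
  Num.sqrt (dot (p - q) (p - q)).

(* 0 is added to the set of distances so that the empty set has diameter 0
   rather than -oo. *)
Definition ediam (R : realType) (n : nat) (A : set 'rV[R]_n) : \bar R :=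
  ereal_sup (0%E |` [set (edist p q)%:E | p in A & q in A]).

(* 2-dimensional Hausdorff outer measure. The factor pi / 4 (the area of a
   planar disc of diameter 1) is the usual normalisation, for which it agrees
   with surface area on smooth surfaces. *)
Section hausdorff2.
Context (R : realType) (n : nat).
Local Open Scope ereal_scope.

Definition hausdorff2_weight (A : set 'rV[R]_n) : \bar R :=
  (pi / 4)%:E * ediam A ^+ 2.

Definition hausdorff2_cover (delta : R) (A : set 'rV[R]_n) :
    set (set 'rV[R]_n)^nat :=
  [set U | A `<=` \bigcup_i U i /\ forall i, ediam (U i) <= delta%:E].

Definition hausdorff2_delta (delta : R) (A : set 'rV[R]_n) : \bar R :=
  ereal_inf [set \sum_(i <oo) hausdorff2_weight (U i)
            | U in hausdorff2_cover delta A].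

(* The supremum over delta is the limit as delta tends to 0, since
   hausdorff2_delta is nonincreasing in delta. *)
Definition hausdorff2 (A : set 'rV[R]_n) : \bar R :=
  ereal_sup [set hausdorff2_delta delta A | delta in [set d : R | (0 < d)%R]].

Lemma ediam_ge0 (A : set 'rV[R]_n) : 0 <= ediam A.
Proof. by apply: ereal_sup_ubound; left. Qed.

Lemma ediam0 : ediam (set0 : set 'rV[R]_n) = 0.
Proof.
apply/eqP; rewrite eq_le ediam_ge0 andbT.
by apply: ge_ereal_sup => x [->//|[p []]].
Qed.

Lemma hausdorff2_weight_ge0 A : 0 <= hausdorff2_weight A.
Proof.
apply: mule_ge0; last by rewrite expe_ge0// ediam_ge0.
by rewrite lee_fin divr_ge0// pi_ge0.
Qed.

Lemma hausdorff2_weight0 : hausdorff2_weight set0 = 0.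
Proof. by rewrite /hausdorff2_weight ediam0 expe2 mule0 mule0. Qed.

Lemma hausdorff2_delta_ge0 delta A : 0 <= hausdorff2_delta delta A.
Proof.
apply: le_ereal_inf_tmp => _ [U _ <-].
by apply: nneseries_ge0 => i _ _; exact: hausdorff2_weight_ge0.
Qed.

Lemma hausdorff2_deltaS delta A B : A `<=` B ->
  hausdorff2_delta delta A <= hausdorff2_delta delta B.
Proof.
move=> AB; apply: ereal_inf_le_tmp => _ [U [BU dU] <-].
by exists U => //; split => //; exact: subset_trans BU.
Qed.

Lemma hausdorff2_delta0 delta : (0 < delta)%R ->
  hausdorff2_delta delta set0 = 0.
Proof.
move=> d0; apply/eqP; rewrite eq_le hausdorff2_delta_ge0 andbT.
apply: ereal_inf_lbound; exists (fun=> set0).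
  by split => [//|i]; rewrite ediam0 lee_fin ltW.
by rewrite eseries0// => i _ _; exact: hausdorff2_weight0.
Qed.

Lemma hausdorff2_delta_sigma_subadditive delta :
  sigma_subadditive (hausdorff2_delta delta).
Proof.
set mu := hausdorff2_delta delta; set w := hausdorff2_weight.
move=> A; have [[i ioo]|] := pselect (exists i, mu (A i) = +oo).
  rewrite (eseries_pinfty _ _ ioo) ?leey// => k _.
  by rewrite -ltNye (lt_le_trans _ (hausdorff2_delta_ge0 _ _)).
rewrite -forallNE => Aoo.
suff add2e (e : {posnum R}) :
    mu (\bigcup_k A k) <= \sum_(i <oo) mu (A i) + e%:num%:E.
  by apply/lee_addgt0Pr => _/posnumP[].
rewrite (le_trans _ (epsilon_trick _ _ _))//; last first.
  by move=> k; exact: hausdorff2_delta_ge0.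
pose P k (B : (set 'rV[R]_n)^nat) := hausdorff2_cover delta (A k) B /\
  \sum_(j <oo) w (B j) <= mu (A k) + (e%:num / (2 ^ k.+1)%:R)%:E.
have [G PG] : {G : ((set 'rV[R]_n)^nat)^nat & forall k, P k (G k)}.
  apply: (@choice _ _ P) => k; rewrite /P.
  have ek : (0 < e%:num / (2 ^ k.+1)%:R)%R by [].
  have mufin : mu (A k) \is a fin_num.
    by rewrite ge0_fin_numE ?hausdorff2_delta_ge0// ltey; apply/eqP.
  have [x [B cB <-] /ltW xS] := lb_ereal_inf_adherent ek mufin.
  by exists B.
have wG_ge0 x : 0 <= (w \o uncurry G) x by exact: hausdorff2_weight_ge0.
apply: (@le_trans _ _ (\esum_(i in setT) (w \o uncurry G) i)).
  apply: ereal_inf_lbound => /=.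
  have /card_esym/ppcard_eqP[f] := card_nat2.
  exists (uncurry G \o f).
    split => [t [k _ /(PG k).1.1[j _ Gt]]|i /=].
      by exists (f^-1%FUN (k, j)) => //=; rewrite invK ?inE.
    by case: (f i) => k j /=; exact: (PG k).1.2.
  rewrite -(esum_pred_image (w \o uncurry G) _ xpredT) ?[fun=> _]set_true//.
  by rewrite image_eq.
rewrite (_ : esum _ _ = \sum_(i <oo) \sum_(j <oo) w (G i j)); last first.
  pose J : nat -> set (nat * nat) := fun i => [set (i, j) | j in setT].
  rewrite (_ : setT = \bigcup_k J k); last first.
    by rewrite predeqE => -[a b]; split => // _; exists a => //; exists b.
  rewrite esum_bigcupT /=; last 2 first.
    - apply/trivIsetP => i j _ _ ij.
      rewrite predeqE => -[k m] /=; split => //= -[] [_] _ [<-{k} _].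
      by move=> [m' _] [] /esym/eqP; rewrite (negbTE ij).
    - by move=> /= [k m]; exact: hausdorff2_weight_ge0.
  rewrite -(image_id [set: nat]) -fun_true esum_pred_image//; last first.
    by move=> k _; apply: esum_ge0 => x _; exact: hausdorff2_weight_ge0.
  apply: eq_eseriesr => /= j _.
  rewrite -(esum_pred_image (w \o uncurry G) (pair j) predT)//=; last 2 first.
    - by move=> k _; exact: hausdorff2_weight_ge0.
    - by move=> ? ? _ _; exact: (@can_inj _ _ _ snd).
  by congr esum; rewrite predeqE => -[a b]; split; move=> [i _ <-]; exists i.
apply: lee_nneseries => [i _ _|i _]; last exact: (PG i).2.
by apply: nneseries_ge0 => j _ _; exact: hausdorff2_weight_ge0.
Qed.

Lemma hausdorff2_delta_le delta A : (0 < delta)%R ->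
  hausdorff2_delta delta A <= hausdorff2 A.
Proof. by move=> d0; apply: ereal_sup_ubound; exists delta. Qed.

Lemma hausdorff2_ge0 A : 0 <= hausdorff2 A.
Proof.
by apply: le_trans (hausdorff2_delta_le _ ltr01); exact: hausdorff2_delta_ge0.
Qed.

Lemma hausdorff2_set0 : hausdorff2 set0 = 0.
Proof.
apply/eqP; rewrite eq_le hausdorff2_ge0 andbT.
by apply: ge_ereal_sup => _ [d d0 <-]; rewrite hausdorff2_delta0.
Qed.

Lemma le_hausdorff2 : {homo hausdorff2 : A B / A `<=` B >-> A <= B}.
Proof.
move=> A B AB; apply: ge_ereal_sup => _ [d d0 <-].
exact: le_trans (hausdorff2_deltaS _ AB) (hausdorff2_delta_le _ d0).
Qed.

Lemma hausdorff2_sigma_subadditive : sigma_subadditive hausdorff2.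
Proof.
move=> F; apply: ge_ereal_sup => _ [d d0 <-].
apply: le_trans (hausdorff2_delta_sigma_subadditive _ _) _.
apply: lee_nneseries => [i _ _|i _]; first exact: hausdorff2_delta_ge0.
exact: hausdorff2_delta_le.
Qed.

HB.instance Definition _ := isOuterMeasure.Build R 'rV[R]_n hausdorff2
  hausdorff2_set0 hausdorff2_ge0 le_hausdorff2 hausdorff2_sigma_subadditive.

End hausdorff2.

(* R^3 with the sigma-algebra of the sets that are Caratheodory measurable for
   the 2-dimensional Hausdorff outer measure; the library makes hausdorff2 a
   (complete) measure on it. *)
Definition space3 (R : realType) := caratheodory_type (@hausdorff2 R 3).

HB.instance Definition _ (R : realType) := Measurable.on (space3 R).

Definition H2 (R : realType) : {measure set (space3 R) -> \bar R} :=
  [the outer_measure R (Pointed.sort 'rV[R]_3) of @hausdorff2 R 3].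

Definition sphere (R : realType) : set (space3 R) :=
  [set p : 'rV[R]_3 | dot p p = 1].
Arguments sphere R : clear implicits.

(* - ln, extended by +oo to the non-positive arguments *)
Definition neg_ln (R : realType) (x : R) : \bar R :=
  if 0 < x then (- ln x)%:E else +oo%E.

(* The functions are defined on the whole space, but only their restrictions
   to the sphere matter. *)
Definition prob_density (R : realType) (f : space3 R -> R) : Prop :=
  [/\ (H2 R).-integrable (sphere R) (EFin \o f),
      {ae H2 R, forall p, sphere R p -> 0 <= f p} &
      (\int[H2 R]_(p in sphere R) (f p)%:E = 1)%E].

Definition mean_field (R : realType) (f : space3 R -> R) (p : space3 R) : R :=
  \int[H2 R]_(q in sphere R) ((dot p q ^+ 2 - 1 / 3) * f q).

(* The conventions 0 * ln 0 = 0 and 0 * +oo = 0 are built into the library's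
   real and extended real products. *)
Definition energy (R : realType) (eta : R) (f : space3 R -> R) : \bar R :=
  (\int[H2 R]_(p in sphere R)
    ((f p * ln (f p))%:E + (f p)%:E * neg_ln (mean_field f p - eta)))%E.

(* Main.v *)
Require Import Defs.
From mathcomp Require Import all_boot all_order all_algebra.
From mathcomp Require Import all_classical all_reals all_analysis.
From mathcomp Require Import measurable_realfun ring lra zify.

Set Implicit Arguments.
Unset Strict Implicit.
Unset Printing Implicit Defensive.
Import Order.TTheory GRing.Theory Num.Theory.
Import numFieldNormedType.Exports.
(* After the libraries, whose [edist] would otherwise shadow the one of Defs. *)
Import Defs.
Local Open Scope classical_set_scope.
Local Open Scope ring_scope.

(* The mean field of [f] depends on [f] only through the nine second moments
   [Q f]. Along a minimising sequence these have a cluster point [v]. Replace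
   the mean field by the one of [v], enlarged by a slack that absorbs the error
   on the moments: the energy becomes a convex functional of [f], to be
   minimised over the convex set of densities whose moments are close to [v].
   The uniform convexity of [x ln x] makes near-minimisers a Cauchy sequence in
   L^1 as the closeness parameter tends to 0. The limit has moments [v], and the
   Fatou lemma, with the joint lower semicontinuity of [t ln t - t ln u], shows
   that it is a minimiser. The energy is finite for a uniform density on a small
   patch when [eta < 2 / 3], since the kernel is close to [2 / 3] there; when
   [2 / 3 <= eta] the argument of the logarithm is never positive. *)

(** * The integrand of the energy *)

(** The density also enters through its own field, so the energy is not convex: the midpoint of two
    near-minimisers has another field. Freezing the field at [v] restores convexity, but a
    minimising sequence reaches the moments [v] only in the limit, and nothing bounds the infimum
    under the exact constraint beforehand. Hence a tolerance on the moments. The sign of the slack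
    matters: the integrand decreases in the field, so an enlarged field keeps every relaxed infimum
    below the true one, and these infima increase as the tolerance shrinks. A bounded monotone
    sequence converges, and this makes near-minimisers at different tolerances comparable. One
    duality, [t ln t - t ln u] as the supremum over [s] of [t s - u exp(s - 1)], supplies the lower
    bound, the uniform convexity and the semicontinuity. *)

Section free_energy_density.
Context {R : realType}.
Implicit Types (a b e s t u K : R).

(** This is [1 + x <= exp x] at [x = s - 1 - ln (t / w)], multiplied by [t]; equality holds at
    [s = 1 + ln (t / w)]. *)
Lemma gibbs_young t w s : 0 <= t -> 0 < w ->
  t * s - w * expR (s - 1) <= t * ln t - t * ln w.
Proof.
rewrite le_eqVlt => /predU1P[<- w0|t0 w0].
  by rewrite !mul0r subrr sub0r oppr_le0 mulr_ge0 ?expR_ge0// ltW.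
have : t * (1 + (s - 1 - (ln t - ln w))) <= t * expR (s - 1 - (ln t - ln w)).
  by apply: ler_wpM2l; [exact: ltW|exact: expR_ge1Dx].
rewrite expRD opprB [expR (ln w - _)]expRD expRN !lnK ?posrE//.
rewrite (_ : t * (_ * (w / t)) = w * expR (s - 1)); last by field; rewrite gt_eqF.
lra.
Qed.

(** From [1 - t <= exp(- t)], the exponential is at most [1 / (1 - t)]; the quadratic bound then
    amounts to [t^2 (1 - 2 t) >= 0]. *)
Lemma expR_le_quadratic t : t <= 1 / 2 -> expR t <= 1 + t + 2 * t ^+ 2.
Proof.
move=> t12; rewrite -[t in leLHS]opprK expRN invf_ple ?posrE ?expR_gt0//; last by nra.
apply: le_trans (expR_ge1Dx _); rewrite invf_ple ?posrE; [|nra..].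
rewrite -[leLHS]div1r ler_pdivrMr; nra.
Qed.

(** For positive [u] this is [t ln (t / u)], the integrand of a relative entropy. *)
Definition ent t u : \bar R := ((t * ln t)%:E + t%:E * neg_ln u)%E.

Lemma ent_gt0E t u : 0 < u -> ent t u = (t * ln t - t * ln u)%:E.
Proof. by move=> u0; rewrite /ent /neg_ln u0 -EFinM -EFinD mulrN. Qed.

Lemma ent0 u : ent 0 u = 0%E.
Proof. by rewrite /ent mul0r mul0e addr0. Qed.

Lemma ent_le0E t u : 0 < t -> u <= 0 -> ent t u = +oo%E.
Proof. by move=> t0 u0; rewrite /ent /neg_ln ltNge u0/= gt0_muley ?lte_fin// addey. Qed.

Lemma ent_ge t u s : 0 <= t ->
  ((t * s - Num.max u 0 * expR (s - 1))%:E <= ent t u)%E.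
Proof.
move=> t0; have [u0|u0] := leP u 0.
  move: t0; rewrite le_eqVlt => /predU1P[<-|t0]; first by rewrite ent0 !mul0r subrr.
  by rewrite ent_le0E// leey.
by rewrite ent_gt0E// lee_fin gibbs_young.
Qed.

(** Slope 0 in [ent_ge], with [exp(-1) <= 1]. The bound does not involve [t], so on a space of
    finite measure it controls the negative part. *)
Lemma ent_geN t u K : 0 <= t -> 0 <= K -> u <= K -> ((- K)%:E <= ent t u)%E.
Proof.
move=> t0 K0 uK; apply: le_trans (ent_ge u 0 t0); rewrite lee_fin mulr0 !sub0r lerN2.
rewrite -[leRHS]mulr1.
by apply: ler_pM => //; [rewrite le_max lexx orbT|rewrite ge_max uK K0].
Qed.

(** Converse of [ent_ge]: [ent t u] is the supremum over [s] of functions that are continuous in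
    [(t, u)], including at [u <= 0]. *)
Lemma ent_approx a t u : 0 <= t -> (a%:E < ent t u)%E ->
  exists s, a < t * s - Num.max u 0 * expR (s - 1).
Proof.
move=> t0; have [u0|u0] := leP u 0.
  move: t0; rewrite le_eqVlt => /predU1P[<-|t0].
    by rewrite ent0 lte_fin => a0; exists 0; rewrite !mul0r subrr.
  move=> _; exists ((a + 1) / t); rewrite mul0r subr0 mulrCA divff ?gt_eqF//.
  by rewrite mulr1 ltrDl.
move: t0; rewrite le_eqVlt => /predU1P[<-|t0].
  (* For [t = 0] the supremum 0 is not attained; this slope makes [u * exp(s - 1)] equal to
     [- a / 2]. *)
  rewrite ent0 lte_fin => a0; exists (1 + ln (- a / (2 * u))).
  rewrite mul0r sub0r addrAC subrr add0r lnK; last first.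
    by rewrite posrE divr_gt0 ?oppr_gt0// mulr_gt0.
  rewrite (_ : u * _ = - a / 2); last by field; rewrite gt_eqF.
  lra.
rewrite ent_gt0E// lte_fin => h; exists (1 + (ln t - ln u)).
rewrite addrAC subrr add0r expRB !lnK ?posrE// mulrCA divff ?gt_eqF// mulr1.
lra.
Qed.

Lemma ent_nincr t u u' : 0 <= t -> u <= u' -> (ent t u' <= ent t u)%E.
Proof.
rewrite le_eqVlt => /predU1P[<-|t0] uu'; first by rewrite !ent0.
have [u0|u0] := leP u 0; first by rewrite (ent_le0E t0 u0) leey.
rewrite !ent_gt0E ?(lt_le_trans u0)// lee_fin lerB// ler_wpM2l ?(ltW t0)//.
by rewrite ler_ln ?posrE ?(lt_le_trans u0).
Qed.

Lemma ent_gtNy t u : 0 <= t -> (-oo < ent t u)%E.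
Proof. by move=> t0; rewrite (lt_le_trans _ (ent_ge u 0 t0))// ltNyr. Qed.

(* Young's inequality with weight (a + b) / 2 and slopes 1 + e and 1 - e. *)
Lemma ent_gap a b u e : 0 <= a -> 0 <= b -> 0 < e <= 1 / 2 ->
  ((e * `|a - b|)%:E + (ent ((a + b) / 2) u + ent ((a + b) / 2) u) <=
   ent a u + ent b u + (2 * e ^+ 2 * (a + b))%:E)%E.
Proof.
wlog ab : a b / b <= a.
  move=> h a0 b0 e0; have [ba|ab] := leP b a; first exact: h.
  by rewrite distrC [a + b]addrC [(ent a u + _)%E]addeC; apply: h => //; exact: ltW.
move=> a0 b0 /andP[e0 e12].
move: (a0); rewrite le_eqVlt => /predU1P[a0'|a1].
  have b0' : b = 0 by apply: le_anti; rewrite b0 {1}a0' ab.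
  by rewrite -a0' b0' subr0 normr0 addr0 mul0r !mulr0 !ent0 !adde0.
have m0 : 0 < (a + b) / 2 by rewrite divr_gt0// ltr_wpDr.
have [u0|u0] := leP u 0.
  rewrite (ent_le0E a1 u0) addye; last by rewrite gt_eqF// ent_gtNy.
  by rewrite addye// leey.
rewrite !ent_gt0E// -!EFinD lee_fin ger0_norm ?subr_ge0//.
(* The [ln u] terms cancel, being linear in the mass. In the sum of the two inequalities the
   exponentials contribute at most [2 m + 4 m e^2], with [4 m e^2 = 2 e^2 (a + b)]. *)
have := gibbs_young (1 + e) a0 m0; have := gibbs_young (1 - e) b0 m0.
rewrite addrAC subrr add0r [1 + e - 1]addrAC subrr add0r.
have e1 : expR e <= 1 + e + 2 * e ^+ 2 by apply: expR_le_quadratic; lra.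
have e2 : expR (- e) <= 1 - e + 2 * e ^+ 2.
  by rewrite -[e ^+ 2]sqrrN; apply: expR_le_quadratic; lra.
have := ler_wpM2l (ltW m0) e1; have := ler_wpM2l (ltW m0) e2.
set m := (a + b) / 2.
have mE x : 2 * (m * x) = a * x + b * x by rewrite /m; field.
have := mE (ln m); have := mE (ln u); have := mE (e ^+ 2); have := mE 1.
by have := mE e; clearbody m; lra.
Qed.

(** A supremum of continuous functions is lower semicontinuous: one of them exceeds any given [a]
    below [ent t u] at the limit point, hence along a tail of the sequence. *)
Lemma ent_lsc (t_ u_ : nat -> R) t u : (forall n, 0 <= t_ n) ->
  t_ @ \oo --> t -> u_ @ \oo --> u ->
  (ent t u <= limn_einf (fun n => ent (t_ n) (u_ n)))%E.
Proof.
move=> t_0 t_t u_u.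
have t0 : 0 <= t.
  have tcv : cvgn t_ by apply/cvg_ex; exists t.
  rewrite -(cvg_lim _ t_t)//; apply: limr_ge => //; exact: nearW.
rewrite limn_einf_lim (cvg_lim (@ereal_hausdorff R) (@cvg_einfs_sup R _)).
have key a : (a%:E < ent t u)%E ->
    (a%:E <= ereal_sup (range (einfs (fun n => ent (t_ n) (u_ n)))))%E.
  move=> /(ent_approx t0)[s as_].
  have cv : (t_ n * s - Num.max (u_ n) 0 * expR (s - 1)) @[n --> \oo] -->
      t * s - Num.max u 0 * expR (s - 1).
    rewrite maxr_absE; under eq_fun do rewrite maxr_absE.
    apply: cvgB; (apply: cvgM; last exact: cvg_cst) => //.
    apply: cvgM; last exact: cvg_cst.
    apply: cvgD; first by apply: cvgD => //; exact: cvg_cst.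
    by apply: cvg_norm; apply: cvgB => //; exact: cvg_cst.
  have [N _ NP] := cvgr_gt _ cv _ as_.
  apply: le_trans (ereal_sup_ubound _); last by exists N.
  apply: le_ereal_inf_tmp => _ [n /= Nn <-].
  by apply: le_trans (ent_ge _ s (t_0 n)); rewrite lee_fin ltW// NP.
case E : (ent t u) => [r| |].
- apply/lee_subgt0Pr => e e0; rewrite -EFinB; apply: key.
  by rewrite E lte_fin ltrBlDr ltrDl.
- rewrite leye_eq; apply/eqP/eqyP => r r0.
  by apply: key; rewrite E ltry.
- exact: leNye.
Qed.

End free_energy_density.

Lemma measurable_neg_ln (R : realType) : measurable_fun [set: R] (@neg_ln R).
Proof.
apply: measurable_fun_ifT => //; first exact: measurable_fun_ltr.
by apply/measurable_EFinP; apply: measurableT_comp => //; exact: measurable_ln.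
Qed.

Lemma measurable_ent d (T : measurableType d) (R : realType) (D : set T)
    (f g : T -> R) : measurable_fun D f -> measurable_fun D g ->
  measurable_fun D (fun x => ent (f x) (g x)).
Proof.
move=> mf mg; apply: emeasurable_funD.
  apply/measurable_EFinP; apply: measurable_funM => //.
  by apply: measurableT_comp => //; exact: measurable_ln.
apply: emeasurable_funM; first exact/measurable_EFinP.
by apply: measurableT_comp mg; exact: measurable_neg_ln.
Qed.

(** * Compactness *)

(** Compactness of a cube, once families over [I] are read as row vectors. A cluster point is
    enough, so no subsequence is extracted. *)
Lemma bounded_cluster (R : realType) (I : finType) (v_ : nat -> I -> R) :
  (forall k i, `|v_ k i| <= 1) ->
  exists2 v : I -> R, (forall i, `|v i| <= 1) &
    forall n e, 0 < e -> exists2 k, (n <= k)%N & forall i, `|v_ k i - v i| <= e.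
Proof.
move=> v1; pose V k := \row_(j < #|I|) v_ k (enum_val j).
have := @rV_compact R #|I| (fun=> [set` `[-1, 1]]) (fun=> @segment_compact _ _ _).
move=> /(_ (V @ \oo) _)[].
  by exists 0%N => // k _ j; rewrite /= mxE in_itv/= -ler_norml.
move=> p [p1 clp]; exists (fun i => p ord0 (enum_rank i)) => [i|n e e0].
  by have := p1 (enum_rank i); rewrite /= in_itv/= -ler_norml.
have [] := clp (V @` [set k | (n <= k)%N]) (ball p e).
- by exists n => // k /= nk; exists k.
- exact: nbhsx_ballx.
move=> _ [[k /= nk <-] pk]; exists k => // i.
have := pk.2 ord0 (enum_rank i); rewrite mxE enum_rankK distrC.
exact: ltW.
Qed.

(** * Almost everywhere limit and domination for a rapidly Cauchy sequence in L^1 *)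

Section L1_summable_increments.
Local Open Scope ereal_scope.
Context d (T : measurableType d) (R : realType) (mu : {measure set T -> \bar R}).
Variables (D : set T) (mD : measurable D) (h : nat -> T -> R).
Hypothesis mh : forall n, measurable_fun D (h n).
Hypothesis h_ge0 : forall n x, (0 <= h n x)%R.
Hypothesis h0_int : mu.-integrable D (EFin \o h 0%N).
Hypothesis h_incr : forall n,
  \int[mu]_(x in D) `|h n.+1 x - h n x|%:E <= (1 / (2 ^ n.+1)%:R)%:E.

Let total_variation x := \sum_(n <oo) `|h n.+1 x - h n x|%:E.
Let bound x := (h 0%N x)%:E + total_variation x.
(** The upper limit is measurable and nonnegative even where the sequence diverges; [fine] turns
    infinite values into 0. *)
Let limit x := fine (limn_esup (fun n => (h n x)%:E)).

Let total_variation_ge0 x : 0 <= total_variation x.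
Proof. by apply: nneseries_ge0 => n _ _; rewrite lee_fin. Qed.

Let m_incr n : measurable_fun D (fun x => `|h n.+1 x - h n x|%:E).
Proof.
apply/measurable_EFinP; apply: measurableT_comp => //.
by apply: measurable_funB; exact: mh.
Qed.

Let total_variation_int : mu.-integrable D total_variation.
Proof.
apply/integrableP; split.
  by apply: (@ge0_emeasurable_sum _ _ _ _ (fun n x => `|h n.+1 x - h n x|%:E) xpredT).
under eq_integral do rewrite gee0_abs//.
rewrite integral_nneseries//.
apply: le_lt_trans (ltry 1%R); apply: le_trans (epsilon_trick0 xpredT ler01).
by apply: lee_nneseries => // n _ _; apply: integral_ge0 => x _; rewrite lee_fin.
Qed.

Let bound_int : mu.-integrable D bound.
Proof. exact: integrableD. Qed.

Let h_le_bound n x : `|(h n x)%:E| <= bound x.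
Proof.
rewrite gee0_abs ?lee_fin//.
rewrite (le_trans (y := (h 0%N x)%:E + \sum_(0 <= k < n) `|h k.+1 x - h k x|%:E))//.
  elim: n => [|n ih]; first by rewrite big_geq// adde0.
  rewrite big_nat_recr//= addeA; apply: le_trans (leeD ih (lexx _)).
  by rewrite lee_fin -lerBlDl ler_norm.
by apply: leeD => //; apply: nneseries_lim_ge => k _ _; rewrite lee_fin.
Qed.

Let h_cvg : {ae mu, forall x, D x -> cvgn (h ^~ x)}.
Proof.
have := integrable_ae mD total_variation_int; apply: filterS => x /[apply] fx.
rewrite (_ : h ^~ x = (fun n => h 0%N x + series (telescope (h ^~ x)) n)%R); last first.
  by apply/funext => n; rewrite -eq_sum_telescope.
apply: is_cvgD; first exact: is_cvg_cst.
apply: normed_cvg; apply: nondecreasing_is_cvgn.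
  by apply: nondecreasing_series => n _ _; exact: normr_ge0.
exists (fine (total_variation x)) => _ [n _ <-].
rewrite -lee_fin fineK// /series/= -sumEFin.
by apply: nneseries_lim_ge => k _ _; rewrite lee_fin.
Qed.

(** The Riesz-Fischer argument: the integrals of the increments sum to at most 1, so the total
    variation is integrable, hence finite almost everywhere. Added to [h 0] it dominates the whole
    sequence. *)
Lemma L1_limit : exists g H : T -> R,
  [/\ measurable_fun D g, forall x, (0 <= g x)%R,
      {ae mu, forall x, D x -> h ^~ x @ \oo --> g x} &
      mu.-integrable D (EFin \o H) /\
      {ae mu, forall x n, D x -> (`|h n x| <= H x)%R}].
Proof.
exists limit, (fine \o bound); split.
- apply: measurableT_comp => //; apply: measurable_fun_limn_esup => n.
  exact/measurable_EFinP.
- move=> x; apply: fine_ge0; rewrite limn_esup_lim; apply: lime_ge.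
    exact: is_cvg_esups.
  apply: nearW => n; apply: (@le_trans _ _ (h n x)%:E); first by rewrite lee_fin.
  by apply: ereal_sup_ubound; exists n => /=.
- move: h_cvg; apply: filterS => x /[apply] /cvg_ex[l hl].
  have /cvg_limn_einf_sup[_ esupE] : (fun n => (h n x)%:E) @ \oo --> l%:E.
    by apply/cvg_EFin => //; exact: nearW.
  by rewrite /limit esupE.
- split.
  + rewrite (_ : _ \o _ = fun x => (fine (bound x))%:E)//.
    have /integrableP[mb lb] := bound_int; apply/integrableP; split.
      by apply/measurable_EFinP; apply: measurableT_comp mb.
    apply: le_lt_trans lb; apply: ge0_le_integral => //.
    * by do 2 apply: measurableT_comp => //; apply: measurableT_comp mb.
    * exact: measurableT_comp.
    * by move=> x _; case: (bound x) => //=; rewrite normr0 ?leey.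
  + have := integrable_ae mD bound_int; apply: filterS => x fx n Dx.
    by rewrite -lee_fin /= fineK ?fx// -abse_EFin h_le_bound.
Qed.

End L1_summable_increments.

(** * Minimisation for a kernel of finite rank *)

(** The integral of [F] may be [+oo], so additivity for integrable functions does not apply. Instead
    the identity between nonnegative functions [(F + K) + F^- = F^+ + K] is integrated, and the
    finite integral of [F^-] is cancelled. *)
Lemma integral_addcst_bounded_below d (T : measurableType d) (R : realType)
    (mu : {measure set T -> \bar R}) (D : set T) (F : T -> \bar R) (K : R) :
  measurable D -> (mu D < +oo)%E -> measurable_fun D F -> 0 <= K ->
  (forall x, D x -> ((- K)%:E <= F x)%E) ->
  (\int[mu]_(x in D) (F x + K%:E) = \int[mu]_(x in D) F x + K%:E * mu D)%E.
Proof.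
move=> mD muD mF K0 FK.
have Kfin : (K%:E * mu D)%E \is a fin_num by rewrite fin_numM// ge0_fin_numE.
have mFp := measurable_funepos mF; have mFn := measurable_funeneg mF.
have intK : (\int[mu]_(x in D) K%:E = K%:E * mu D)%E by rewrite integral_cst.
have Fn_fin : (\int[mu]_(x in D) F^\- x)%E \is a fin_num.
  rewrite ge0_fin_numE; last by apply: integral_ge0 => x _; exact: funeneg_ge0.
  apply: (@le_lt_trans _ _ (K%:E * mu D)%E); last by rewrite -ge0_fin_numE// mule_ge0.
  rewrite -intK; apply: ge0_le_integral => //.
  by move=> x Dx; rewrite funenegE ge_max lee_fin K0 andbT leeNl -EFinN; exact: FK.
have key : (\int[mu]_(x in D) (F x + K%:E) + \int[mu]_(x in D) F^\- x =
    \int[mu]_(x in D) F^\+ x + K%:E * mu D)%E.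
  rewrite -intK -!ge0_integralD//; last first.
  - by apply: emeasurable_funD.
  - by move=> x Dx; rewrite -leeBlDr// sub0e; exact: FK.
  apply: eq_integral => x /[!inE] /FK; rewrite [in LHS]addeAC funeposE funenegE.
  case: (F x) => [r| |] //= _; last by rewrite maxye maxNye adde0.
  rewrite -!EFin_max -!EFinD; congr (_ + _)%:E.
  have [r0|r0] := leP 0 r; first by rewrite max_r ?oppr_le0// addr0.
  by rewrite max_l ?subrr// oppr_ge0 ltW.
by rewrite (integralE mu D F) addeAC -key addeK.
Qed.

Section mean_field_minimisation.
Local Open Scope ereal_scope.
Context d (T : measurableType d) (R : realType) (mu : {measure set T -> \bar R}).
Variables (D : set T) (mD : measurable D) (muD : mu D < +oo).
Variables (I : finType) (phi : I -> T -> R) (c : R).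
Hypothesis mphi : forall i, measurable_fun D (phi i).
Hypothesis phi_le1 : forall i x, D x -> (`|phi i x| <= 1)%R.

(** Nonnegativity is required everywhere; a density that is nonnegative only almost everywhere is
    later replaced by its positive part. *)
Definition density (f : T -> R) := [/\ measurable_fun D f,
  forall x, (0 <= f x)%R & \int[mu]_(x in D) (f x)%:E = 1].

Definition moment (f : T -> R) (i : I) : R := (\int[mu]_(x in D) (phi i x * f x))%R.

Definition potential (v : I -> R) (x : T) : R := (\sum_i v i * phi i x - c)%R.

(** For coefficients in [[-1, 1]] the potential is at most [#|I| + |c|], and the slack is at most
    [#|I|]. *)
Let K : R := (2 * #|I|%:R + `|c|)%R.

(* The constant [K] makes the integrand nonnegative. *)
Definition shifted_energy (f : T -> R) (v : I -> R) (delta : R) : \bar R :=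
  \int[mu]_(x in D) (ent (f x) (potential v x + delta) + K%:E).

Lemma density_integrable f : density f -> mu.-integrable D (EFin \o f).
Proof.
move=> [mf f0 f1]; apply/integrableP; split; first exact/measurable_EFinP.
under eq_integral => x _ do rewrite gee0_abs ?lee_fin//.
by rewrite f1 ltry.
Qed.

Lemma density_uniform P : measurable P -> P `<=` D -> 0 < mu P ->
  density (fun x => (fine (mu P))^-1 * \1_P x)%R.
Proof.
move=> mP PD P0.
have Pfin : mu P \is a fin_num.
  rewrite ge0_fin_numE//; apply: le_lt_trans muD.
  by apply: le_measure => //; rewrite inE.
have m0 : (0 < fine (mu P))%R by rewrite -lte_fin fineK.
split.
- by apply: measurable_funM => //.
- by move=> x; rewrite mulr_ge0// invr_ge0 ltW.
- under eq_integral do rewrite EFinM.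
  rewrite ge0_integralZl_EFin ?invr_ge0 ?(ltW m0)//; last exact/measurable_EFinP.
  rewrite integral_indic// setIidl// -[mu P in X in _ * X]fineK// -EFinM.
  by rewrite mulVf// gt_eqF.
Qed.

Lemma moment_integrable f i : density f ->
  mu.-integrable D (fun x => (phi i x * f x)%:E).
Proof.
move=> df; have [mf f0 f1] := df; apply: (le_integrable mD) (density_integrable df).
  by apply/measurable_EFinP; exact: measurable_funM.
move=> x Dx; rewrite lee_fin normrM -[leRHS]mul1r ler_wpM2r// phi_le1//.
Qed.

Lemma moment_le1 f i : density f -> (`|moment f i| <= 1)%R.
Proof.
move=> df; have [mf f0 f1] := df.
apply: le_trans (le_normr_Rintegral mD (moment_integrable i df)) _.
have -> : 1%R = (\int[mu]_(x in D) f x)%R by rewrite /Rintegral f1.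
apply: le_Rintegral => //.
- exact: integrable_norm (moment_integrable i df).
- exact: density_integrable.
- by move=> x Dx; rewrite normrM -[leRHS]mul1r (ger0_norm (f0 x)) ler_wpM2r// phi_le1.
Qed.

Lemma density_midpoint f g : density f -> density g ->
  density (fun x => (f x + g x) / 2)%R.
Proof.
move=> [mf f0 f1] [mg g0 g1]; split.
- by apply: measurable_funM => //; exact: measurable_funD.
- by move=> x; rewrite divr_ge0// addr_ge0.
- under eq_integral do rewrite mulrC EFinM EFinD.
  rewrite ge0_integralZl_EFin//; last first.
    by apply: emeasurable_funD; exact/measurable_EFinP.
    by move=> x _; rewrite -EFinD lee_fin addr_ge0.
  rewrite ge0_integralD//; last 4 first.
  - by move=> x _; rewrite lee_fin.
  - exact/measurable_EFinP.
  - by move=> x _; rewrite lee_fin.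
  - exact/measurable_EFinP.
  by rewrite f1 g1 -EFinD -EFinM; congr EFin; field.
Qed.

Lemma moment_midpoint f g i : density f -> density g ->
  moment (fun x => (f x + g x) / 2)%R i = ((moment f i + moment g i) / 2)%R.
Proof.
move=> df dg; rewrite /moment -RintegralD//; [|exact: moment_integrable..].
rewrite -RintegralZr//; last first.
  exact: (integrableD mD (moment_integrable i df) (moment_integrable i dg)).
by apply: eq_Rintegral => x _; ring.
Qed.

Lemma potential_le v x delta : D x -> (forall i, `|v i| <= 1)%R ->
  (delta <= #|I|%:R)%R -> (potential v x + delta <= K)%R.
Proof.
move=> Dx v1 dI; rewrite /potential /K.
have : (\sum_i v i * phi i x <= #|I|%:R)%R.
  rewrite -sumr_const; apply: ler_sum => i _.
  apply: le_trans (ler_norm _) _; rewrite normrM -[leRHS]mulr1.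
  by apply: ler_pM => //; exact: phi_le1.
have := ler_norm (- c)%R; rewrite normrN; lra.
Qed.

Lemma K_ge0 : (0 <= K)%R.
Proof. by rewrite addr_ge0// mulr_ge0. Qed.

Lemma shifted_ge0 f v delta x : D x -> (0 <= f x)%R -> (forall i, `|v i| <= 1)%R ->
  (delta <= #|I|%:R)%R -> 0 <= ent (f x) (potential v x + delta) + K%:E.
Proof.
move=> Dx f0 v1 dI; rewrite -leeBlDr// sub0e.
exact: ent_geN K_ge0 (potential_le Dx v1 dI).
Qed.

Lemma measurable_potential v : measurable_fun D (potential v).
Proof.
apply: measurable_funB => //; apply: measurable_sum => i.
exact: measurable_funM.
Qed.

Lemma measurable_shifted f v delta : measurable_fun D f ->
  measurable_fun D (fun x => ent (f x) (potential v x + delta) + K%:E).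
Proof.
move=> mf; apply: emeasurable_funD => //; apply: measurable_ent => //.
by apply: measurable_funD => //; exact: measurable_potential.
Qed.

Lemma shifted_energy_ge0 f v delta : density f -> (forall i, `|v i| <= 1)%R ->
  (delta <= #|I|%:R)%R -> 0 <= shifted_energy f v delta.
Proof.
by move=> [mf f0 _] v1 dI; apply: integral_ge0 => x Dx; exact: shifted_ge0.
Qed.

(** [ent_gap] integrated at a frozen potential; the total mass 2 of [f] and [g] turns [2 e^2] into
    [4 e^2]. The midpoint energy is added on the left rather than subtracted, since energies may be
    infinite. *)
Lemma shifted_energy_gap f g v delta e : density f -> density g ->
    (forall i, `|v i| <= 1)%R -> (delta <= #|I|%:R)%R -> (0 < e <= 1 / 2)%R ->
  let m := shifted_energy (fun x => (f x + g x) / 2)%R v delta in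
  e%:E * (\int[mu]_(x in D) `|f x - g x|%:E) + (m + m) <=
  shifted_energy f v delta + shifted_energy g v delta + (4 * e ^+ 2)%:E.
Proof.
move=> df dg v1 dI e12; have dm := density_midpoint df dg.
have [mf f0 f1] := df; have [mg g0 g1] := dg; have [mm m0 m1] := dm.
have mabs : measurable_fun D (fun x => (`|f x - g x|)%:E).
  by apply/measurable_EFinP; apply: measurableT_comp => //; exact: measurable_funB.
have msum : measurable_fun D (fun x => (f x)%:E + (g x)%:E).
  by apply: emeasurable_funD; exact/measurable_EFinP.
have e2 : (0 <= 2 * e ^+ 2)%R by rewrite mulr_ge0// sqr_ge0.
have [e0 _] := andP e12.
have sh0 h : density h -> forall x, D x -> 0 <= ent (h x) (potential v x + delta) + K%:E.
  by move=> [_ h0 _] x Dx; exact: shifted_ge0.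
have msh h : density h -> measurable_fun D (fun x => ent (h x) (potential v x + delta) + K%:E).
  by move=> [mh _ _]; exact: measurable_shifted.
rewrite /shifted_energy -ge0_integralZl_EFin ?(ltW e0)//.
have -> : (4 * e ^+ 2)%:E = \int[mu]_(x in D) ((2 * e ^+ 2)%:E * ((f x)%:E + (g x)%:E)).
  rewrite ge0_integralZl_EFin//; last by move=> x _; rewrite -EFinD lee_fin addr_ge0.
  rewrite ge0_integralD//; last 4 first.
  - by move=> x _; rewrite lee_fin.
  - exact/measurable_EFinP.
  - by move=> x _; rewrite lee_fin.
  - exact/measurable_EFinP.
  by rewrite f1 g1 -EFinD -EFinM; congr EFin; ring.
have shm := sh0 _ dm; have shf := sh0 _ df; have shg := sh0 _ dg.
have mshm := msh _ dm; have mshf := msh _ df; have mshg := msh _ dg.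
have m1' : measurable_fun D (fun x => e%:E * (`|f x - g x|)%:E) by exact: measurable_funeM.
have m2' : measurable_fun D (fun x => (2 * e ^+ 2)%:E * ((f x)%:E + (g x)%:E)).
  exact: measurable_funeM.
have p1 x : D x -> 0 <= e%:E * (`|f x - g x|)%:E.
  by move=> _; rewrite mule_ge0// lee_fin ltW.
have p2 x : D x -> 0 <= (2 * e ^+ 2)%:E * ((f x)%:E + (g x)%:E).
  by move=> _; rewrite -EFinD -EFinM lee_fin mulr_ge0// addr_ge0.
rewrite -ge0_integralD// -ge0_integralD//; last 2 first.
- by move=> x Dx; rewrite adde_ge0 ?shm.
- exact: emeasurable_funD.
rewrite -ge0_integralD// -ge0_integralD//; last 2 first.
- by move=> x Dx; apply: adde_ge0; [exact: shf|exact: shg].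
- exact: emeasurable_funD.
apply: ge0_le_integral => //.
- by move=> x Dx; apply: adde_ge0; [exact: p1|apply: adde_ge0; exact: shm].
- by apply: emeasurable_funD => //; exact: emeasurable_funD.
- by apply: emeasurable_funD => //; exact: emeasurable_funD.
move=> x Dx; have gap := ent_gap (potential v x + delta) (f0 x) (g0 x) e12.
rewrite -EFinD -!EFinM ![_ + K%:E + (_ + K%:E)]addeACA [leLHS]addeA [leRHS]addeAC.
exact: leeD2r.
Qed.

Lemma shifted_energy_mono f v w delta delta' : density f ->
  (forall i, `|v i| <= 1)%R -> (delta <= #|I|%:R)%R ->
  (forall i, `|w i| <= 1)%R -> (delta' <= #|I|%:R)%R ->
  (forall x, D x -> potential v x + delta <= potential w x + delta')%R ->
  shifted_energy f w delta' <= shifted_energy f v delta.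
Proof.
move=> [mf f0 _] v1 dI w1 dI' vw; apply: ge0_le_integral => //.
- by move=> x Dx; exact: shifted_ge0.
- exact: measurable_shifted.
- exact: measurable_shifted.
- by move=> x Dx; apply: leeD2r; apply: ent_nincr (f0 x) _; exact: vw.
Qed.

Lemma potential_close v w x e : D x -> (forall i, `|w i - v i| <= e)%R ->
  (potential w x <= potential v x + #|I|%:R * e)%R.
Proof.
move=> Dx vw; rewrite -lerBlDl /potential opprD addrACA subrr addr0 -sumrB.
rewrite mulr_natl -sumr_const; apply: ler_sum => i _.
rewrite -mulrBl; apply: le_trans (ler_norm _) _; rewrite normrM -[leRHS]mulr1.
by apply: ler_pM => //; exact: phi_le1.
Qed.

(** * Near-minimisers whose moments approach a prescribed vector *)

Section prescribed_moment.
Variables (v : I -> R) (m : R).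
Hypothesis v1 : forall i, (`|v i| <= 1)%R.

Let admissible n f :=
  density f /\ forall i, (`|moment f i - v i| <= n.+1%:R^-1)%R.
(** By [potential_close], the largest change of the potential when each moment moves by at most
    [1 / (n + 1)]. *)
Let slack n : R := (#|I|%:R * n.+1%:R^-1)%R.

Hypothesis near_minimisers : forall n e, (0 < e)%R ->
  exists2 f, admissible n f & shifted_energy f (moment f) 0 <= (m + e)%:E.

Let slack_le n : (slack n <= #|I|%:R)%R.
Proof. by rewrite /slack ler_piMr// invf_le1// ler1n. Qed.

Let slack_nincr n k : (n <= k)%N -> (slack k <= slack n)%R.
Proof. by move=> nk; rewrite ler_wpM2l// lef_pV2 ?posrE// ler_nat. Qed.

Let inf_energy n := ereal_inf [set shifted_energy f v (slack n) | f in admissible n].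

Let inf_energy_ge0 n : 0 <= inf_energy n.
Proof.
by apply: le_ereal_inf_tmp => _ [f [df _] <-]; exact: shifted_energy_ge0.
Qed.

Let inf_energy_lb n f : admissible n f -> inf_energy n <= shifted_energy f v (slack n).
Proof. by move=> af; apply: ereal_inf_lbound; exists f. Qed.

(** For admissible [f] the potential of [v] plus the slack lies above that of [moment f], and a
    larger potential means a smaller energy. *)
Let inf_energy_le n : inf_energy n <= m%:E.
Proof.
apply/lee_addgt0Pr => e e0; have [f af fe] := near_minimisers n e0.
apply: le_trans (inf_energy_lb af) _; apply: le_trans fe.
have [df vf] := af; apply: shifted_energy_mono => //.
- by move=> i; exact: moment_le1.
- by move=> x Dx; rewrite addr0; exact: potential_close.
Qed.

Let inf_fin n : inf_energy n \is a fin_num.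
Proof.
by rewrite ge0_fin_numE ?inf_energy_ge0// (le_lt_trans (inf_energy_le n))// ltry.
Qed.

Let j n : R := fine (inf_energy n).

Let jE n : (j n)%:E = inf_energy n.
Proof. by rewrite /j fineK. Qed.

Let j_le n : (j n <= m)%R.
Proof. by rewrite -lee_fin jE. Qed.

Let admissible_le n k f : (n <= k)%N -> admissible k f -> admissible n f.
Proof.
move=> nk [df vf]; split=> // i; apply: le_trans (vf i) _.
by rewrite lef_pV2 ?posrE// ler_nat.
Qed.

Let energy_slack_le n k f : (n <= k)%N -> density f ->
  shifted_energy f v (slack n) <= shifted_energy f v (slack k).
Proof.
by move=> nk df; apply: shifted_energy_mono => // x _; rewrite lerD2l slack_nincr.
Qed.

(** A larger index shrinks the admissible set and lowers the potential; both raise the infimum. *)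
Let j_nd : {homo j : n k / (n <= k)%N >-> (n <= k)%R}.
Proof.
move=> n k nk; apply: (fine_le (inf_fin n) (inf_fin k)).
apply: le_ereal_inf_tmp => _ [f af <-].
apply: le_trans (inf_energy_lb (admissible_le nk af)) _.
exact: energy_slack_le nk af.1.
Qed.

Let j_cvg : cvgn j.
Proof. by apply: nondecreasing_is_cvgn => //; exists m => _ [n _ <-]. Qed.

Let near_optimal n := [set f | admissible n f /\
  shifted_energy f v (slack n) <= (j n + n.+1%:R^-1)%:E].

Let midpoint_admissible n f g : admissible n f -> admissible n g ->
  admissible n (fun x => (f x + g x) / 2)%R.
Proof.
move=> [df vf] [dg vg]; split; first exact: density_midpoint.
move=> i; rewrite moment_midpoint//.
have -> : ((moment f i + moment g i) / 2 - v i =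
  (moment f i - v i) / 2 + (moment g i - v i) / 2)%R by field.
apply: le_trans (ler_normD _ _) _; rewrite !normrM [`|2^-1|%R]ger0_norm//.
have := vf i; have := vg i; move: (n.+1%:R^-1)%R => r; lra.
Qed.

(** The midpoint is admissible at the coarser level [n], so its energy is at least [j n]. In the gap
    inequality this leaves only the excess of the energies of [f] and [g] over [j n]. *)
Let near_optimal_close n k f g e : (n <= k)%N -> near_optimal k f -> near_optimal n g ->
  (0 < e <= 1 / 2)%R ->
  e%:E * \int[mu]_(x in D) `|f x - g x|%:E <=
  (j k - j n + 2 * n.+1%:R^-1 + 4 * e ^+ 2)%:E.
Proof.
move=> nk [af ef] [ag eg] e12; have af' := admissible_le nk af.
have /= := shifted_energy_gap af.1 ag.1 v1 (slack_le n) e12.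
have := inf_energy_lb (midpoint_admissible af' ag); rewrite -jE.
set M := shifted_energy (fun x => _) v _ => jM gap.
have knr : (k.+1%:R^-1 <= n.+1%:R^-1 :> R)%R by rewrite lef_pV2 ?posrE// ler_nat.
have : e%:E * (\int[mu]_(x in D) `|f x - g x|%:E) + ((j n)%:E + (j n)%:E) <=
    (j k + n.+1%:R^-1)%:E + (j n + n.+1%:R^-1)%:E + (4 * e ^+ 2)%:E.
  apply: le_trans (leeD (lexx _) (leeD jM jM)) _.
  apply: le_trans gap _; apply: leeD2r; apply: (leeD _ eg).
  apply: le_trans (energy_slack_le nk af.1) _; apply: le_trans ef _.
  by rewrite lee_fin lerD2l.
clear; move: (j k) (j n) (n.+1%:R^-1)%R => a b t.
rewrite -EFinD -!EFinD -leeBrDr// -EFinB => /le_trans; apply.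
by rewrite lee_fin le_eqVlt; apply/orP; left; apply/eqP; ring.
Qed.

Let near_optimal_exists n : exists f, near_optimal n f.
Proof.
have n0 : (0 < n.+1%:R^-1 :> R)%R by rewrite invr_gt0.
have [_ [f af <-] fe] := lb_ereal_inf_adherent n0 (inf_fin n).
by exists f; split => //; rewrite EFinD jE ltW.
Qed.

Let near_optimal_cauchy l : exists N, forall n k f g, (N <= n)%N -> (n <= k)%N ->
  near_optimal k f -> near_optimal n g ->
  \int[mu]_(x in D) `|f x - g x|%:E <= (1 / (2 ^ l.+1)%:R)%:E.
Proof.
pose r : R := (1 / (2 ^ l.+1)%:R)%R.
have r0 : (0 < r)%R by rewrite divr_gt0// ltr0n expn_gt0.
have r1 : (r <= 1)%R by rewrite /r ler_pdivrMr ?ltr0n ?expn_gt0// mul1r ler1n expn_gt0.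
(* After division by [e], the error [4 e^2] costs [r / 2], while [j k - j n < 2 t] and
   [2 / (n + 1) < 2 t] cost [r / 4] each. *)
pose e : R := (r / 8)%R; pose t : R := (e * r / 8)%R.
have e0 : (0 < e)%R by rewrite divr_gt0.
have t0 : (0 < t)%R by rewrite !mulr_gt0// invr_gt0.
have /cvgrPdist_lt/(_ _ t0)[N1 _ N1P] := j_cvg.
have /cvgrPdist_lt/(_ _ t0)[N2 _ N2P] := @cvg_harmonic R.
exists (maxn N1 N2) => n k f g; rewrite geq_max => /andP[n1 n2] nk of_ og.
have e12 : (0 < e <= 1 / 2)%R by rewrite e0 /e; lra.
have := near_optimal_close nk of_ og e12.
have h1 := N1P n n1; have h2 := N1P k (leq_trans n1 nk).
have h3 := N2P n n2; rewrite /= sub0r normrN in h3.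
rewrite -lee_pdivlMl// => /le_trans; apply.
rewrite -EFinM lee_fin mulrC ler_pdivrMr// -/r.
have e2E : (4 * e ^+ 2 = e * r / 2)%R by rewrite /e; field.
rewrite e2E; move: h1 h2 h3.
move: (limn j) (j n) (j k) (n.+1%:R^-1)%R => a b b' q; rewrite !ltr_norml /t; lra.
Qed.

Lemma prescribed_moment_minimiser : exists2 g, density g &
  shifted_energy g (moment g) 0 <= m%:E.
Proof.
have [G GP] := choice near_optimal_exists.
have [N NP] := choice near_optimal_cauchy.
(* Nondecreasing and above [N l], so that the increments of [G (s l)] are summable; above [l], so
   that tolerance and slack tend to 0. *)
pose s l := (\sum_(i < l.+1) N i + l)%N.
have sS l : (s l <= s l.+1)%N.
  by rewrite /s [in X in (_ <= X)%N]big_ord_recr/=; lia.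
have sN l : (N l <= s l)%N by rewrite /s big_ord_recr/=; lia.
have sl l : (l <= s l)%N by rewrite /s leq_addl.
pose h l := G (s l).
have dh l : density (h l) := (GP (s l)).1.1.
have [g [H [mg g0 hg [intH hH]]]] : exists g H : T -> R,
  [/\ measurable_fun D g, forall x, (0 <= g x)%R,
      {ae mu, forall x, D x -> h ^~ x @ \oo --> g x} &
      mu.-integrable D (EFin \o H) /\
      {ae mu, forall x n, D x -> (`|h n x| <= H x)%R}].
  apply: L1_limit => //.
  - by move=> n; have [] := dh n.
  - by move=> n x; have [] := dh n.
  - exact: density_integrable.
  - by move=> n; exact: (NP n _ _ _ _ (sN n) (sS n)).
have hgE : {ae mu, forall x, D x -> (fun n => (h n x)%:E) @ \oo --> (g x)%:E}.
  move: hg; apply: filterS => x /[apply] hg.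
  by apply/cvg_EFin => //; exact: nearW.
have [_ _ cvg1] := @dominated_convergence _ _ _ mu D mD
  (fun n x => (h n x)%:E) (EFin \o g) (EFin \o H)
  (fun n => (measurable_EFinP _ _).2 (let: And3 mh _ _ := dh n in mh))
  ((measurable_EFinP _ _).2 mg) hgE intH hH.
have g1 : \int[mu]_(x in D) (g x)%:E = 1.
  move: cvg1 => /=; under eq_fun do rewrite (let: And3 _ _ h1 := dh _ in h1).
  by move=> /cvg_lim <-//; rewrite lim_cst.
have dg : density g by split.
exists g => //.
have soo : s @ \oo --> \oo.
  by apply/cvgnyPge => A; exists A => // l /= Al; exact: leq_trans (sl l).
have s0 : ((s l).+1%:R^-1)%R @[l --> \oo] --> (0 : R)%R.
  exact: (cvg_comp _ _ soo (@cvg_harmonic R)).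
have mom_g i : moment g i = v i.
  have cv : {ae mu, forall x, D x ->
      (fun n => (phi i x * h n x)%:E) @ \oo --> (phi i x * g x)%:E}.
    move: hg; apply: filterS => x /[apply] hgx; apply/cvg_EFin; first exact: nearW.
    by apply: cvgM => //; exact: cvg_cst.
  have bd : {ae mu, forall x n, D x -> `|(phi i x * h n x)%:E| <= (EFin \o H) x}.
    move: hH; apply: filterS => x hHx n Dx; rewrite lee_fin.
    apply: le_trans (hHx n Dx); rewrite normrM -[leRHS]mul1r.
    by rewrite ler_wpM2r// phi_le1.
  have [_ _ /= cvgm] := @dominated_convergence _ _ _ mu D mD
    (fun n x => (phi i x * h n x)%:E) (fun x => (phi i x * g x)%:E) (EFin \o H)
    (fun n => measurable_int _ (moment_integrable i (dh n)))
    (measurable_int _ (moment_integrable i dg)) cv intH bd.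
  have {}cvgm : moment (h n) i @[n --> \oo] --> moment g i.
    apply: fine_cvg; rewrite /moment /Rintegral fineK//.
    exact: integrable_fin_num (moment_integrable i dg).
  apply: (cvg_unique _ cvgm) => //; apply/cvgrPdist_le => e e0.
  have /cvgrPdist_le/(_ _ e0)[N0 _ N0P] := s0.
  exists N0 => // n N0n; rewrite distrC.
  apply: le_trans ((GP (s n)).1.2 i) _.
  by apply: le_trans (N0P n N0n); rewrite sub0r normrN ger0_norm.
have -> : moment g = v by apply/funext.
pose F l x := ent (h l x) (potential v x + slack (s l)) + K%:E.
have F0 l x : D x -> 0 <= F l x.
  by move=> Dx; apply: shifted_ge0 => //; have [] := dh l.
have mF l : measurable_fun D (F l) by apply: measurable_shifted; have [] := dh l.
apply: (@le_trans _ _ (\int[mu]_(x in D) limn_einf (F ^~ x))).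
  apply: ae_ge0_le_integral => //.
  - by move=> x Dx; exact: shifted_ge0.
  - exact: measurable_shifted.
  - move=> x Dx; rewrite limn_einf_lim; apply: lime_ge; first exact: is_cvg_einfs.
    by apply: nearW => n; apply: le_ereal_inf_tmp => _ [l _ <-]; exact: F0.
  - have mE : measurable_fun D (fun x => limn_esup (fun n => - F n x)).
      apply: (@measurable_fun_limn_esup _ _ _ _ (fun n x => - F n x)) => n.
      exact: measurableT_comp.
    exact: (measurableT_comp (@oppe_measurable R setT) mE).
  - move: hg; apply: filterS => x /[apply] hgx.
    rewrite (_ : F ^~ x = fun l => K%:E + ent (h l x) (potential v x + slack (s l))).
      rewrite limn_einf_shift// [leLHS]addeC; apply: leeD2l.
      apply: ent_lsc => //.
        by move=> l; have [] := dh l.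
      apply: cvgD; first exact: cvg_cst.
      rewrite -[X in _ --> X](mulr0 #|I|%:R); apply: cvgM => //; exact: cvg_cst.
    by apply/funext => l; rewrite /F addeC.
apply: le_trans (fatou mu mD mF F0) _.
rewrite limn_einf_lim; apply: lime_le; first exact: is_cvg_einfs.
(* A tail infimum is at most its term of index [maxn n N0], whose energy is at most
   [j + 1 / (s + 1) <= m + e]. *)
apply: nearW => n; apply/lee_addgt0Pr => e e0.
have /cvgrPdist_le/(_ _ e0)[N0 _ N0P] := s0.
apply: (@le_trans _ _ (\int[mu]_(x in D) F (maxn n N0) x)).
  by apply: ereal_inf_lbound; exists (maxn n N0) => //=; rewrite leq_maxl.
apply: le_trans (GP (s (maxn n N0))).2 _.
have := N0P _ (leq_maxr n N0); rewrite /= sub0r normrN ger0_norm// => se.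
by rewrite -EFinD lee_fin lerD.
Qed.

End prescribed_moment.
Lemma shifted_energyE f : density f -> shifted_energy f (moment f) 0 =
  \int[mu]_(x in D) ent (f x) (potential (moment f) x) + K%:E * mu D.
Proof.
move=> df; have [mf f0 _] := df; rewrite /shifted_energy.
under eq_integral do rewrite addr0.
apply: integral_addcst_bounded_below => //.
- by apply: measurable_ent => //; exact: measurable_potential.
- exact: K_ge0.
- move=> x Dx; apply: ent_geN => //; first exact: K_ge0.
  by rewrite -[leLHS]addr0; apply: potential_le => // i; exact: moment_le1.
Qed.

Theorem mean_field_minimiser_exists :
  (exists2 f, density f & \int[mu]_(x in D) ent (f x) (potential (moment f) x) < +oo) ->
  exists2 g, density g & \int[mu]_(x in D) ent (g x) (potential (moment g) x) < +oo /\
    forall f, density f -> \int[mu]_(x in D) ent (g x) (potential (moment g) x) <=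
      \int[mu]_(x in D) ent (f x) (potential (moment f) x).
Proof.
move=> [f1 df1 Ef1].
have Kfin : K%:E * mu D \is a fin_num by rewrite fin_numM// ge0_fin_numE.
pose E f := shifted_energy f (moment f) 0.
have E0 f : density f -> 0 <= E f.
  by move=> df; apply: shifted_energy_ge0 => // i; exact: moment_le1.
pose m0 := ereal_inf [set E f | f in density].
have m0fin : m0 \is a fin_num.
  rewrite ge0_fin_numE; last by apply: le_ereal_inf_tmp => _ [f df <-]; exact: E0.
  apply: (@le_lt_trans _ _ (E f1)); first by apply: ereal_inf_lbound; exists f1.
  by rewrite /E shifted_energyE// lte_add_pinfty// ltey_eq Kfin.
have mE : m0 = (fine m0)%:E by rewrite fineK.
have near k : exists f, density f /\ E f <= m0 + (k.+1%:R^-1)%:E.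
  have k0 : (0 < k.+1%:R^-1 :> R)%R by rewrite invr_gt0.
  have [_ [f df <-] fe] := lb_ereal_inf_adherent k0 m0fin.
  by exists f; split => //; exact: ltW.
have [u uP] := choice near.
have [v v1 vP] := @bounded_cluster R I (fun k => moment (u k))
  (fun k i => moment_le1 i (uP k).1).
have [|g dg gm] := @prescribed_moment_minimiser v (fine m0) v1.
  (* The cluster property yields an index beyond [N], so that one [u k] has both moments close to
     [v] and energy close to the infimum. *)
  move=> n e e0; have n0 : (0 < n.+1%:R^-1 :> R)%R by rewrite invr_gt0.
  have /cvgrPdist_le/(_ _ e0)[N _ NP] := @cvg_harmonic R.
  have [k Nk kv] := vP N _ n0.
  exists (u k); first by split=> //; exact: (uP k).1.
  apply: le_trans (uP k).2 _; rewrite EFinD -mE leeD2l// lee_fin.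
  by have := NP k Nk; rewrite /= sub0r normrN ger0_norm.
rewrite -mE in gm.
have gmin f : density f -> \int[mu]_(x in D) ent (g x) (potential (moment g) x) <=
      \int[mu]_(x in D) ent (f x) (potential (moment f) x).
  move=> df; have m0_le : m0 <= E f by apply: ereal_inf_lbound; exists f.
  have := le_trans gm m0_le.
  by rewrite /E (shifted_energyE dg) (shifted_energyE df) leeD2rE.
exact: (ex_intro2 _ _ g dg (conj (le_lt_trans (gmin _ df1) Ef1) gmin)).
Qed.

Lemma mean_field_energy_lty f C : density f -> (0 <= C)%R ->
  (forall x, D x -> ent (f x) (potential (moment f) x) <= C%:E) ->
  \int[mu]_(x in D) ent (f x) (potential (moment f) x) < +oo.
Proof.
move=> df C0 fC; have [mf f0 _] := df.
have Kmu : 0 <= K%:E * mu D by rewrite mule_ge0// lee_fin K_ge0.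
apply: (@le_lt_trans _ _ (shifted_energy f (moment f) 0)).
  by rewrite shifted_energyE// leeDl.
apply: (@le_lt_trans _ _ (\int[mu]_(x in D) (C + K)%:E)).
  apply: ge0_le_integral => //.
  - move=> x Dx; apply: shifted_ge0 => // i; exact: moment_le1.
  - exact: measurable_shifted.
  - by move=> x Dx; rewrite addr0 (EFinD C K); apply: leeD2r; exact: fC.
rewrite integral_cst// -ge0_fin_numE; last first.
  by rewrite mule_ge0// lee_fin addr_ge0// K_ge0.
by rewrite fin_numM// ge0_fin_numE.
Qed.

(* The integrand exceeds every multiple of [f]. *)
Lemma mean_field_energy_pinfty f : density f ->
  (forall x, D x -> potential (moment f) x <= 0)%R ->
  \int[mu]_(x in D) ent (f x) (potential (moment f) x) = +oo.
Proof.
move=> df field0; have [mf f0 f1] := df.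
have Kfin : K%:E * mu D \is a fin_num by rewrite fin_numM// ge0_fin_numE.
suff shy : shifted_energy f (moment f) 0 = +oo.
  move: shy; rewrite shifted_energyE//.
  by case: (\int[mu]_(x in D) _) Kfin => [e| |] //; case: (K%:E * mu D).
apply/eqyP => A A0.
have -> : A%:E = \int[mu]_(x in D) (A%:E * (f x)%:E).
  rewrite ge0_integralZl_EFin ?(ltW A0)// ?f1 ?mule1//; first by move=> x _; rewrite lee_fin.
  exact/measurable_EFinP.
apply: ge0_le_integral => //.
- by move=> x _; rewrite -EFinM lee_fin mulr_ge0// ltW.
- by apply: measurable_funeM; exact/measurable_EFinP.
- exact: measurable_shifted.
move=> x Dx; rewrite addr0.
have := f0 x; rewrite le_eqVlt => /predU1P[<-|fx0].
  by rewrite ent0 mule0 add0e lee_fin K_ge0.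
by rewrite ent_le0E ?field0// addye// leey.
Qed.

End mean_field_minimisation.

(** * The Hausdorff measure on the sphere *)

Section euclidean_distance.
Context {R : realType} {n : nat}.
Implicit Types (p q : 'rV[R]_n) (A B : set 'rV[R]_n).

Lemma dist_coord_le p q i : `|p 0 i - q 0 i| <= edist p q.
Proof.
rewrite -sqrtr_sqr ler_sqrt; last by apply: sumr_ge0 => j _; exact: sqr_ge0.
rewrite /dot (bigD1 i)//= !mxE -expr2 lerDl.
by apply: sumr_ge0 => j _; rewrite -expr2 sqr_ge0.
Qed.

Lemma edist_le_ediam A p q : A p -> A q -> ((edist p q)%:E <= ediam A)%E.
Proof. by move=> Ap Aq; apply: ereal_sup_ubound; right; exists p => //; exists q. Qed.

Lemma ediam_le A (r : R) : 0 <= r ->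
  (forall p q, A p -> A q -> edist p q <= r) -> (ediam A <= r%:E)%E.
Proof.
move=> r0 Ar; apply: ge_ereal_sup => _ [->|[p Ap [q Aq <-]]]; rewrite lee_fin//.
exact: Ar.
Qed.

End euclidean_distance.

(** * Additivity of the Hausdorff measure on separated sets *)

Section hausdorff_separated.
Local Open Scope ereal_scope.
Context {R : realType} {n : nat}.
Implicit Types (A B X : set 'rV[R]_n).

Lemma le_hausdorff2_delta (e d : R) A : (e <= d)%R ->
  hausdorff2_delta d A <= hausdorff2_delta e A.
Proof.
move=> ed; apply: ereal_inf_le_tmp => _ [U [AU dU] <-].
by exists U => //; split=> // i; apply: le_trans (dU i) _; rewrite lee_fin.
Qed.

(** No set of diameter at most [d] meets both [A] and [B], so a cover of the union splits into two
    covers, padded with empty sets. *)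
Lemma hausdorff2_delta_separated (d : R) A B :
  (forall p q, A p -> B q -> (d < edist p q)%R) ->
  hausdorff2_delta d A + hausdorff2_delta d B <= hausdorff2_delta d (A `|` B).
Proof.
move=> sepAB; apply: le_ereal_inf_tmp => _ [U [ABU dU] <-].
pose meetsA i := `[< exists2 p, A p & U i p >].
pose UA i := if meetsA i then U i else set0.
pose UB i := if meetsA i then set0 else U i.
apply: (@le_trans _ _ (\sum_(i <oo) hausdorff2_weight (UA i) +
                       \sum_(i <oo) hausdorff2_weight (UB i))).
  have d0 : ediam (set0 : set 'rV[R]_n) <= d%:E.
    by apply: le_trans (dU 0%N); rewrite ediam0 ediam_ge0.
  apply: leeD; apply: ereal_inf_lbound.
  - exists UA => //; split => [p Ap|i]; last by rewrite /UA; case: ifP.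
    have [i _ Uip] := ABU p (or_introl Ap).
    by exists i => //; rewrite /UA ifT//; apply/asboolP; exists p.
  - exists UB => //; split => [q Bq|i]; last by rewrite /UB; case: ifP.
    have [i _ Uiq] := ABU q (or_intror Bq).
    exists i => //; rewrite /UB ifF//; apply/asboolPn => -[p Ap Uip].
    have := le_trans (edist_le_ediam Uip Uiq) (dU i).
    by rewrite lee_fin leNgt sepAB.
rewrite -nneseriesD; [|by move=> i _ _; exact: hausdorff2_weight_ge0..].
apply: lee_nneseries => [i _ _|i _].
  by apply: adde_ge0; exact: hausdorff2_weight_ge0.
by rewrite /UA /UB; case: ifP => _; rewrite hausdorff2_weight0 ?adde0 ?add0e.
Qed.

Lemma hausdorff2_separated (r : R) A B : (0 < r)%R ->
  (forall p q, A p -> B q -> (r <= edist p q)%R) ->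
  hausdorff2 A + hausdorff2 B <= hausdorff2 (A `|` B).
Proof.
move=> r0 sepAB; set c := hausdorff2 (A `|` B).
have [->|cfin] := eqVneq c +oo; first exact: leey.
have cA : hausdorff2 A <= c by apply: le_hausdorff2 => x; left.
have cB : hausdorff2 B <= c by apply: le_hausdorff2 => x; right.
have fin0 x : 0 <= x -> x <= c -> x \is a fin_num.
  by move=> x0 xc; rewrite ge0_fin_numE// (le_lt_trans xc)// ltey.
have key d1 d2 : (0 < d1)%R -> (0 < d2)%R ->
    hausdorff2_delta d1 A + hausdorff2_delta d2 B <= c.
  (* A common scale, finer than both; [r / 2] keeps it strictly below the separation. *)
  move=> d10 d20; pose d := Num.min (Num.min d1 d2) (r / 2)%R.
  have dd : (d <= d1)%R /\ (d <= d2)%R /\ (d <= r / 2)%R.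
    by rewrite /d !ge_min !lexx /= !orbT.
  have [dd1 [dd2 dr]] := dd.
  apply: (@le_trans _ _ (hausdorff2_delta d A + hausdorff2_delta d B)).
    by apply: leeD; exact: le_hausdorff2_delta.
  apply: le_trans (hausdorff2_delta_separated _) _.
    by move=> p q Ap Bq; apply: lt_le_trans (sepAB _ _ Ap Bq); lra.
  apply: hausdorff2_delta_le; rewrite /d !lt_min d10 d20/=; lra.
rewrite -leeBrDr; last exact: fin0 (hausdorff2_ge0 _) cB.
apply: ge_ereal_sup => _ [d1 /= d10 <-].
have hA : hausdorff2_delta d1 A \is a fin_num.
  apply: fin0; first exact: hausdorff2_delta_ge0.
  exact: le_trans (hausdorff2_delta_le _ d10) cA.
rewrite leeBrDr; last exact: fin0 (hausdorff2_ge0 _) cB.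
rewrite addeC -leeBrDr//; apply: ge_ereal_sup => _ [d2 /= d20 <-].
by rewrite leeBrDr// addeC key.
Qed.

End hausdorff_separated.

(** * Caratheodory measurability of half-spaces *)

Section halfspace_measurable.
Local Open Scope ereal_scope.
Context {R : realType} {n : nat}.
Variables (i : 'I_n) (c : R).

Let mu := @hausdorff2 R n.
Let t (k : nat) : R := (c + k.+1%:R^-1)%R.
Let above (X : set 'rV[R]_n) (s : R) := X `&` [set p | (s < p 0%R i)%R].
Let shell (X : set 'rV[R]_n) k := X `&` [set p | (t k.+1 < p 0%R i <= t k)%R].

Let separated (X A B : set 'rV[R]_n) (s s' : R) : (s < s')%R ->
  A `<=` X `&` [set p | (p 0%R i <= s)%R] -> B `<=` above X s' ->
  mu A + mu B <= mu X.
Proof.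
move=> ss' AX BX; apply: (@le_trans _ _ (mu (A `|` B))); last first.
  by apply: le_hausdorff2 => p [/AX[]|/BX[]].
apply: (@hausdorff2_separated _ _ (s' - s)%R); first by rewrite subr_gt0.
move=> p q /AX[_ /= ps] /BX[_ /= qs]; apply: le_trans (dist_coord_le p q i).
by rewrite distrC; apply: le_trans (ler_norm _); lra.
Qed.

Let t_nincr k l : (k <= l)%N -> (t l <= t k)%R.
Proof. by move=> kl; rewrite /t lerD2l lef_pV2 ?posrE// ler_nat. Qed.

Let t_decr k : (t k.+1 < t k)%R.
Proof. by rewrite /t ltrD2l ltf_pV2 ?posrE// ltr_nat. Qed.

Let above_cover X m : above X c `<=`
  above X (t m) `|` \bigcup_k shell X (m + k)%N.
Proof.
move=> p [Xp /= cp]; have [tp|tp] := ltP (t m) (p 0%R i); first by left; split.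
right; have gap : (0 < p 0%R i - c)%R by rewrite subr_gt0.
have [N _ NP] := cvgr_lt _ (@cvg_harmonic R) _ gap.
have exk : exists k, (t (m + k)%N < p 0%R i)%R.
  exists N; have := NP (m + N)%N (leq_addl _ _).
  by rewrite /harmonic /= ltrBrDl.
(* The least index whose threshold lies below the coordinate is not 0, because the coordinate is at
   most [t m]; its predecessor names the shell. *)
have [[|k] kp kmin] := ex_minnP exk; first by move: kp; rewrite addn0 ltNge tp.
exists k => //; split=> //=; rewrite -addnS kp /= leNgt.
by apply/negP => /kmin; rewrite ltnn.
Qed.

(* Consecutive shells are not separated, but shells two steps apart are: the
   measures of the shells are dominated by the increments over two steps of a
   bounded monotone sequence, so that their sum converges. *)
Lemma halfspace_caratheodory : mu.-caratheodory [set p | (p 0%R i <= c)%R].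
Proof.
apply: le_caratheodory_measurable => X.
have -> : X `&` ~` [set p | (p 0%R i <= c)%R] = above X c.
  apply/seteqP; split => p [Xp /= cp]; split => //=.
    by rewrite ltNge; apply/negP.
  by apply/negP; rewrite -ltNge.
set S := X `&` _; change (mu S + mu (above X c) <= mu X).
have [->|Xfin] := eqVneq (mu X) +oo; first exact: leey.
have fin A : A `<=` X -> mu A \is a fin_num.
  move=> AX; rewrite ge0_fin_numE; last exact: hausdorff2_ge0.
  by apply: le_lt_trans (le_hausdorff2 AX) _; rewrite ltey.
have afin s : mu (above X s) \is a fin_num by apply: fin => p [].
pose a k := fine (mu (above X (t k))).
have aE k : (a k)%:E = mu (above X (t k)) by rewrite /a fineK.
have a_nd : {homo a : k l / (k <= l)%N >-> (k <= l)%R}.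
  move=> k l kl; apply: fine_le => //; apply: le_hausdorff2 => p [Xp /= tp].
  by split => //=; exact: le_lt_trans (t_nincr kl) tp.
have a_le k : (a k <= fine (mu X))%R.
  by apply: fine_le => //; [exact: fin|apply: le_hausdorff2 => p []].
have a_cvg : cvgn a.
  by apply: nondecreasing_is_cvgn => //; exists (fine (mu X)) => _ [k _ <-].
have a_lim k : (a k <= limn a)%R by exact: nondecreasing_cvgn_le.
have shell_le k : mu (shell X k.+1) <= (a k.+2 - a k)%:E.
  rewrite EFinB !aE leeBrDr//; apply: (separated (t_decr k)).
  - by move=> p [Xp /= /andP[p1 p2]]; split => //; split.
  - move=> p [Xp /= p1]; split => //; split => //=.
    by apply: le_lt_trans p1; exact: t_nincr (leqW (leqnSn k)).
have tail m : \sum_(k <oo) mu (shell X (m.+1 + k)%N) <= (2 * (limn a - a m))%:E.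
  apply: lime_le; first by apply: is_cvg_nneseries => k _ _; exact: hausdorff2_ge0.
  apply: nearW => N.
  apply: (@le_trans _ _ (\sum_(0 <= k < N) (a (m + k).+2 - a (m + k)%N)%:E)).
    by apply: lee_sum => k _; rewrite addSn.
  rewrite sumEFin lee_fin.
  (* Pairing consecutive terms makes the two-step increments telescope. *)
  pose b k := (a (m + k)%N + a (m + k).+1)%R.
  rewrite (eq_bigr (fun k => b k.+1 - b k)%R); last first.
    by move=> k _; rewrite /b addnS; ring.
  rewrite telescope_sumr// /b addn0.
  have := a_lim (m + N)%N; have := a_lim (m + N).+1; have := a_nd _ _ (leqnSn m).
  lra.
apply/lee_addgt0Pr => e e0.
have e20 : (0 < e / 2)%R by rewrite divr_gt0.
have /cvgrPdist_lt/(_ _ e20)[m _ /(_ m (leqnn m)) mP] := a_cvg.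
have main : mu S + mu (above X (t m.+1)) <= mu X.
  apply: (@separated _ _ _ c (t m.+1)) => //.
  by rewrite /t ltrDl invr_gt0.
apply: (@le_trans _ _ (mu S + (mu (above X (t m.+1)) + e%:E))); last first.
  by rewrite addeA leeD2r.
apply: leeD2l; apply: le_trans (le_hausdorff2 (@above_cover X m.+1)) _.
apply: le_trans (outer_measureU2 _ _ _) _; apply: leeD2l.
apply: le_trans (hausdorff2_sigma_subadditive _) _.
apply: le_trans (tail m) _; rewrite lee_fin.
move: mP; rewrite ger0_norm ?subr_ge0//; lra.
Qed.

End halfspace_measurable.

Section space3_measurable.
Context {R : realType}.

Lemma measurable_coord (i : 'I_3) :
  measurable_fun setT (fun p : space3 R => (p : 'rV[R]_3) 0 i).
Proof.
apply: (measurability _ (RGenOInfty.measurableE R)) => //.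
move=> _ [_ [x ->] <-]; rewrite setTI.
rewrite (_ : _ @^-1` _ = ~` [set p : 'rV[R]_3 | p 0 i <= x]).
  apply: measurableC; exact: halfspace_caratheodory.
by apply/seteqP; split => p /=; rewrite in_itv/= andbT ltNge => /negP.
Qed.

Lemma measurable_dot (p : 'rV[R]_3) : measurable_fun setT (fun q : space3 R => dot p q).
Proof.
apply: measurable_sum => i; apply: measurable_funM; first exact: measurable_cst.
exact: measurable_coord.
Qed.

Lemma measurable_sphere : measurable (sphere R : set (space3 R)).
Proof.
have md : measurable_fun setT (fun p : space3 R => dot (p : 'rV[R]_3) p).
  apply: measurable_sum => i; apply: measurable_funM; exact: measurable_coord.
rewrite (_ : sphere R = (fun p : space3 R => dot (p : 'rV[R]_3) p) @^-1` [set 1]) //.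
by rewrite -[_ @^-1` _]setTI; exact: md.
Qed.

End space3_measurable.

(** Addition in ['I_3] is modulo 3, so any axis can be put first and the three axes are treated at
    once. *)
Lemma sum_ord3 (V : nmodType) (i : 'I_3) (f : 'I_3 -> V) :
  \sum_j f j = f i + f (i + 1) + f (i + 2).
Proof.
rewrite (bigD1 i)//= (bigD1 (i + 1)) /=; last by case: i => -[|[|[|]]].
rewrite (bigD1 (i + 2)) /=; last by case: i => -[|[|[|]]].
rewrite big_pred0 ?addr0 ?addrA// => j.
by case: i j => -[|[|[|//]]] ? [[|[|[|//]]] ?].
Qed.

(** * Area of the sphere and of its patches *)

Section sphere_measure.
Context {R : realType}.
Implicit Types p q : 'rV[R]_3.

Lemma dot3E p q (i : 'I_3) :
  dot p q = p 0 i * q 0 i + p 0 (i + 1) * q 0 (i + 1) + p 0 (i + 2) * q 0 (i + 2).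
Proof. by rewrite /dot (sum_ord3 i). Qed.

Lemma hausdorff2_delta_fin_cover n (I : finType) (U : I -> set 'rV[R]_n)
    (A : set 'rV[R]_n) (r d : R) : 0 <= r -> r <= d ->
  A `<=` \bigcup_(i in [set: I]) U i -> (forall i, (ediam (U i) <= r%:E)%E) ->
  (hausdorff2_delta d A <= (#|I|%:R * (pi / 4 * r ^+ 2))%:E)%E.
Proof.
move=> r0 rd AU Ur.
pose V k := if insub k is Some j then U (enum_val (j : 'I_#|I|)) else set0.
have Vr k : (ediam (V k) <= r%:E)%E.
  by rewrite /V; case: insubP => [j _ _|_]; rewrite ?Ur// ediam0 lee_fin.
apply: (@le_trans _ _ (\sum_(k <oo) hausdorff2_weight (V k))%E).
  apply: ereal_inf_lbound; exists V => //; split => [p /AU[i _ Uip]|k].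
    exists (enum_rank i) => //; rewrite /V; case: insubP => [j _ ji|]; last first.
      by rewrite ltn_ord.
    by rewrite (val_inj ji) enum_rankK.
  by apply: le_trans (Vr k) _; rewrite lee_fin.
rewrite (nneseries_split 0 #|I|); last by move=> k _; exact: hausdorff2_weight_ge0.
rewrite eseries0 ?adde0; last first.
  move=> k Ik _; rewrite /V insubN ?hausdorff2_weight0// -leqNgt.
  by rewrite add0n in Ik.
rewrite add0n mulr_natl -[#|I| in leRHS]subn0 -sumr_const_nat -sumEFin.
apply: lee_sum => k _; rewrite /hausdorff2_weight [leRHS]EFinM.
apply: lee_wpmul2l; first by rewrite lee_fin divr_ge0// pi_ge0.
by rewrite EFin_expe lee_sqr ?ediam_ge0.
Qed.

Lemma sphere_coord_le p i : dot p p = 1 -> -1 <= p 0 i <= 1.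
Proof.
rewrite (dot3E _ _ i) => pp; nra.
Qed.

End sphere_measure.

(** Subtracting the two sphere equations expresses [(a1 - b1)(a1 + b1)] through the other
    coordinates, and [|a1 + b1| >= 1] on a piece; so [|a1 - b1| <= 4 h], and [16 + 1 + 1 <= 25]. *)
Lemma sphere_chord_le (R : realFieldType) (s h a1 a2 a3 b1 b2 b3 : R) :
  a1 * a1 + a2 * a2 + a3 * a3 = 1 -> b1 * b1 + b2 * b2 + b3 * b3 = 1 ->
  s ^+ 2 = 1 -> 1 / 2 <= s * a1 -> 1 / 2 <= s * b1 ->
  `|a2 - b2| <= h -> `|a3 - b3| <= h ->
  (a1 - b1) * (a1 - b1) + (a2 - b2) * (a2 - b2) + (a3 - b3) * (a3 - b3)
    <= (5 * h) ^+ 2.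
Proof.
move=> a1E b1E s1 sa sb h2 h3.
have h0 : 0 <= h := le_trans (normr_ge0 _) h2.
have coord1 (x y z : R) : x * x + y * y + z * z = 1 -> `|y| <= 1 /\ `|z| <= 1.
  by move=> xyz; rewrite !ler_norml; split; nra.
have [na2 na3] := coord1 _ _ _ a1E; have [nb2 nb3] := coord1 _ _ _ b1E.
have prod_le x y : `|x - y| <= h -> `|x| <= 1 -> `|y| <= 1 ->
    `|(x - y) * (x + y)| <= h * 2.
  move=> xyh x1 y1; rewrite normrM; apply: ler_pM => //.
  by apply: le_trans (ler_normD _ _) _; lra.
have e2 := prod_le _ _ h2 na2 nb2; have e3 := prod_le _ _ h3 na3 nb3.
have e1 : `|a1 - b1| <= 4 * h.
  have -> : `|a1 - b1| = `|s * (a1 - b1)|.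
    have : `|s| = 1 by apply/eqP; rewrite -sqr_norm_eq1 s1.
    by rewrite normrM => ->; rewrite mul1r.
  apply: (@le_trans _ _ (`|s * (a1 - b1)| * `|s * (a1 + b1)|)).
    rewrite ler_peMr//; apply: le_trans (ler_norm _); lra.
  rewrite -normrM.
  have -> : s * (a1 - b1) * (s * (a1 + b1)) =
     - ((a2 - b2) * (a2 + b2) + (a3 - b3) * (a3 + b3)).
    have -> : s * (a1 - b1) * (s * (a1 + b1)) = s ^+ 2 * (a1 * a1 - b1 * b1) by ring.
    by rewrite s1; lra.
  by rewrite normrN; apply: le_trans (ler_normD _ _) _; lra.
have sq x (k : R) : `|x| <= k -> x * x <= k * k.
  move=> xk; rewrite -[x * x]ger0_norm -?expr2 ?sqr_ge0// normrX expr2.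
  exact: ler_pM.
have := sq _ _ h2; have := sq _ _ h3; have := sq _ _ e1.
have := mulr_ge0 h0 h0; lra.
Qed.

Section sphere_area.
Context {R : realType}.
Implicit Types p q : 'rV[R]_3.

Lemma edist_le p q (r : R) : 0 <= r -> dot (p - q) (p - q) <= r ^+ 2 -> edist p q <= r.
Proof.
by move=> r0 pq; rewrite -[leRHS]ger0_norm// -sqrtr_sqr ler_wsqrtr.
Qed.

(* On each of the six pieces where one coordinate has absolute value at least
   1/2, the sphere is a Lipschitz graph over the other two coordinates. *)
Lemma hausdorff2_sphere_lty : (hausdorff2 (sphere R : set 'rV[R]_3) < +oo)%E.
Proof.
(* There are [6 N^2] cells with [N <= 3 M], each of diameter at most [5 / M]:
   [6 * 9 * 25 = 1350]. *)
apply: (@le_lt_trans _ _ (1350 * (pi / 4))%:E); last exact: ltry.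
apply: ge_ereal_sup => _ [d /= d0 <-].
pose M := (Num.truncn (5 / d)).+1.
have M0 : 0 < M%:R :> R by rewrite ltr0n.
have Md : 5 * M%:R^-1 <= d.
  by rewrite ler_pdivrMr// mulrC -ler_pdivrMr// ltW// truncnS_gt.
(* [2 M] cells of width [1 / M] fill [[-1, 1[]; one more receives the endpoint 1. *)
pose N := (2 * M).+1.
pose I := ('I_3 * bool * ('I_N * 'I_N))%type.
pose in_cell (x : R) (a : 'I_N) := a%:R <= M%:R * (x + 1) < a.+1%:R.
pose U (k : I) := [set p | dot p p = 1 /\ [/\ 1 / 2 <= (-1) ^+ k.1.2 * p 0 k.1.1,
  in_cell (p 0 (k.1.1 + 1)) k.2.1 & in_cell (p 0 (k.1.1 + 2)) k.2.2]].
have cell_close x y a : in_cell x a -> in_cell y a -> `|x - y| <= M%:R^-1.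
  rewrite /in_cell -natr1 => /andP[xa xa1] /andP[ya ya1].
  rewrite -[leRHS]mul1r ler_pdivlMr// -[M%:R in leLHS]ger0_norm ?(ltW M0)//.
  by rewrite -normrM ler_norml mulrC; apply/andP; split; lra.
have cell_ex x : -1 <= x <= 1 -> exists a, in_cell x a.
  move=> /andP[x1 x2]; have y0 : 0 <= M%:R * (x + 1).
    by rewrite mulr_ge0 ?(ltW M0)//; lra.
  have lt_N : (Num.truncn (M%:R * (x + 1)) < N)%N.
    rewrite truncn_lt_nat// /N -natr1 natrM ltr_pwDr//.
    by rewrite mulrC ler_pM2r//; lra.
  by exists (Ordinal lt_N); apply: truncn_itv.
apply: (@le_trans _ _ (#|{: I}|%:R * (pi / 4 * (5 * M%:R^-1) ^+ 2))%:E).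
  apply: (@hausdorff2_delta_fin_cover _ _ _ U) => //.
  - move=> p pp; have [i pi2] : exists i, 1 / 2 <= `|p 0 i|.
      apply: contrapT => /forallNP small.
      have lt14 i : p 0 i * p 0 i < 1 / 4.
        have /negP := small i; rewrite -ltNge ltr_norml => /andP[? ?]; nra.
      have : dot p p = 1 := pp; rewrite (dot3E _ _ 0).
      have := lt14 0; have := lt14 (0 + 1); have := lt14 (0 + 2); lra.
    have [a pa] := cell_ex _ (sphere_coord_le (i + 1) pp).
    have [b pb] := cell_ex _ (sphere_coord_le (i + 2) pp).
    exists (i, p 0 i < 0, (a, b)) => //; split => //; split => //=.
    by rewrite -normrEsign.
  - move=> [[i s] [a b]]; apply: ediam_le; first by rewrite mulr_ge0// invr_ge0 ltW.
    move=> p q [/= pp [pi2 pa pb]] [/= qq [qi2 qa qb]].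
    apply: edist_le; first by rewrite mulr_ge0// invr_ge0 ltW.
    rewrite (dot3E _ _ i) !mxE; rewrite !(dot3E _ _ i) in pp qq.
    apply: sphere_chord_le pp qq _ pi2 qi2 _ _.
    + exact: sqrr_sign.
    + exact: cell_close pa qa.
    + exact: cell_close pb qb.
rewrite lee_fin !card_prod !card_ord card_bool mulrCA [leRHS]mulrC.
apply: ler_wpM2l; first by rewrite divr_ge0// pi_ge0.
have N3 : N%:R <= 3 * M%:R :> R.
  by rewrite /N -natr1 natrM; have : 1 <= M%:R :> R; [rewrite ler1n|lra].
rewrite exprMn exprVn !natrM.
rewrite (_ : _ * _ = (150 * (N%:R * N%:R)) / M%:R ^+ 2); last by ring.
rewrite ler_pdivrMr ?exprn_gt0//.
have : (N%:R * N%:R <= (3 * M%:R) * (3 * M%:R) :> R) by apply: ler_pM.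
lra.
Qed.

Definition patch (r : R) : set 'rV[R]_3 := [set p | dot p p = 1 /\
  [/\ 0 <= p 0 0 <= r, 0 <= p 0 1 <= r & 0 <= p 0 2]].

(* The orthogonal projection of the patch on the first two coordinates is a
   square, and it does not increase distances. *)
Lemma hausdorff2_patch_gt0 (r : R) : 0 < r <= 1 / 2 -> (0 < hausdorff2 (patch r))%E.
Proof.
move=> /andP[r0 r12].
have c0 : 0 < pi / 16 * (r * r) by rewrite !mulr_gt0// ?pi_gt0// invr_gt0.
(* A set of diameter [d] projects into a square of side [2 d], whose area [4 d^2] is [16 / pi] times
   the weight [pi / 4 * d^2]. Covers at scale 1 already give the bound. *)
apply: (@lt_le_trans _ _ (pi / 16 * (r * r))%:E); first by rewrite lte_fin.
apply: le_trans (hausdorff2_delta_le _ ltr01).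
apply: le_ereal_inf_tmp => _ [U [PU U1] <-].
have dfin k : ediam (U k) \is a fin_num.
  by rewrite ge0_fin_numE ?ediam_ge0// (le_lt_trans (U1 k))// ltry.
pose d k := fine (ediam (U k)).
have d0 k : 0 <= d k by rewrite fine_ge0// ediam_ge0.
have dE k : (d k)%:E = ediam (U k) by rewrite /d fineK.
(* Some point of [U k]; when [U k] is empty the default value is harmless, as [d k = 0] makes the
   square degenerate. *)
pose c k := get (U k).
pose side k i := [set` `[c k 0 i - d k, c k 0 i + d k]] : set R.
pose L := (@lebesgue_measure R \x @lebesgue_measure R)%E.
pose I0 : set R := [set` `[0, r]].
pose Q := I0 `*` I0.
pose B k := side k 0 `*` side k 1.
have QB : Q `<=` \bigcup_k B k.
  move=> [x y] []; rewrite /I0/= !in_itv/= => /andP[x0 xr] /andP[y0 yr].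
  pose p : 'rV[R]_3 := \row_j if j == 0 then x else if j == 1 then y
    else Num.sqrt (1 - x ^+ 2 - y ^+ 2).
  have Pp : patch r p.
    split; last by split; rewrite !mxE/= ?x0 ?y0 ?xr ?yr ?sqrtr_ge0.
    rewrite (dot3E _ _ 0) !mxE/= -[X in _ + X]expr2 sqr_sqrtr; last by nra.
    by ring.
  have [k _ Ukp] := PU p Pp.
  have Ukc : U k (c k) by apply: getPex; exists p.
  exists k => //; have pc := edist_le_ediam Ukp Ukc.
  have near i : `|p 0 i - c k 0 i| <= d k.
    by apply: le_trans (dist_coord_le p (c k) i) _; rewrite -lee_fin dE.
  have := near 0; have := near 1; rewrite !mxE/= !ler_norml => /andP[? ?] /andP[? ?].
  by split; rewrite /side/= in_itv/=; apply/andP; split; lra.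
have mside k i : measurable (side k i) by exact: measurable_itv.
have LQ : L Q = (r * r)%:E.
  transitivity (lebesgue_measure I0 * lebesgue_measure I0)%E.
    by apply: product_measure1E; exact: measurable_itv.
  by rewrite /I0 !lebesgue_measure_itv/= lte_fin r0 sube0 EFinM.
have LB k : (L (B k) = (16 / pi)%:E * hausdorff2_weight (U k))%E.
  transitivity (lebesgue_measure (side k 0%R) * lebesgue_measure (side k 1%R))%E.
    by apply: product_measure1E; exact: mside.
  have sideE i : lebesgue_measure (side k i) = (2 * d k)%:E.
    rewrite lebesgue_measure_itv/= lte_fin; case: ltP => h.
      by rewrite -EFinB; congr EFin; ring.
    have -> : d k = 0 by apply: le_anti; rewrite d0 andbT; lra.
    by rewrite mulr0.
  rewrite !sideE /hausdorff2_weight -dE -EFin_expe -!EFinM; congr EFin.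
  by move: (@pi_gt0 R) => /lt0r_neq0; move: pi => x x0; field.
have mB k : measurable (B k) by exact: measurableX.
have mQ : measurable Q by apply: measurableX; exact: measurable_itv.
have : (L Q <= \sum_(k <oo) L (B k))%E.
  exact: (measure_sigma_subadditive
    (@lebesgue_measure R \x @lebesgue_measure R)%E mB mQ QB).
rewrite LQ (eq_eseriesr (fun k _ => LB k)) nneseriesZl; last first.
  by move=> k _; exact: hausdorff2_weight_ge0.
rewrite -lee_pdivrMl ?divr_gt0 ?pi_gt0// -EFinM invf_div; apply: le_trans.
by rewrite lee_fin.
Qed.

End sphere_area.

(** * The energy on the sphere *)

Lemma Rintegral_sum d (T : measurableType d) (R : realType)
    (mu : {measure set T -> \bar R}) (D : set T) (I : Type) (s : seq I)
    (F : I -> T -> R) : measurable D ->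
  (forall i, mu.-integrable D (EFin \o F i)) ->
  \int[mu]_(x in D) (\sum_(i <- s) F i x) = \sum_(i <- s) \int[mu]_(x in D) F i x.
Proof.
move=> mD intF; rewrite /Rintegral; under eq_integral do rewrite -sumEFin.
by rewrite integral_sum// sum_fine// => i _; exact: (integrable_fin_num mD (intF i)).
Qed.

Section sphere_energy.
Context {R : realType}.
Variable eta : R.
Implicit Types (f : space3 R -> R) (p q : space3 R).

Let S : set (space3 R) := sphere R.

Let quad (ij : 'I_3 * 'I_3) p : R := (p : 'rV[R]_3) 0 ij.1 * (p : 'rV[R]_3) 0 ij.2.

(** Against a density the [1/3] of the kernel integrates to [1/3], and joins [eta]. *)
Let c : R := eta + 1 / 3.

Let mS : measurable S. Proof. exact: measurable_sphere. Qed.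

Let S_lty : (H2 R S < +oo)%E. Proof. exact: hausdorff2_sphere_lty. Qed.

Let measurable_quad ij : measurable_fun S (quad ij).
Proof.
by apply: measurable_funTS; apply: measurable_funM; exact: measurable_coord.
Qed.

Let quad_le1 ij p : S p -> `|quad ij p| <= 1.
Proof.
move=> Sp; rewrite normrM -[leRHS]mulr1.
by apply: ler_pM => //; rewrite ler_norml (sphere_coord_le _ Sp).
Qed.

Let dens f := density (H2 R) S f.
Let mom f := moment (H2 R) S quad f.
Let fld f p := potential quad c (mom f) p.

(** Expanding [(p . q)^2] as the sum of [p_i p_j q_i q_j] separates the variables. *)
Let mean_field_fld f p : dens f -> mean_field f p - eta = fld f p.
Proof.
move=> df; have intf := density_integrable df.
have intq ij := moment_integrable mS measurable_quad quad_le1 ij df.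
(* [None] indexes the constant part of the kernel. *)
pose F (o : option ('I_3 * 'I_3)) q : R :=
  if o is Some ij then quad ij p * (quad ij q * f q) else - (1 / 3) * f q.
have intF o : (H2 R).-integrable S (EFin \o F o).
  case: o => [ij|]; first exact: (integrableZl mS _ (intq ij)).
  exact: (integrableZl mS _ intf).
have -> : mean_field f p = \int[H2 R]_(q in S)
    (\sum_(o <- None :: map Some (enum [set: 'I_3 * 'I_3]%SET)) F o q).
  apply: eq_Rintegral => q _; rewrite big_cons big_map big_enum /=.
  rewrite /dot expr2 big_distrlr/= pair_big/= mulrBl -mulNr addrC big_distrl/=.
  congr (_ + _); apply: eq_big => [ij|ij _]; first by rewrite inE.
  by rewrite /quad /=; ring.
rewrite Rintegral_sum// big_cons big_map big_enum/= RintegralZl//.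
rewrite {1}/Rintegral; have [_ _ ->] := df; rewrite /fld /potential /c mulr1.
have -> : \sum_(ij in [set: 'I_3 * 'I_3]%SET)
    \int[H2 R]_(x in S) (quad ij p * (quad ij x * f x)) =
    \sum_ij mom f ij * quad ij p.
  apply: eq_big => [ij|ij _]; first by rewrite inE.
  by rewrite (RintegralZl _ mS (intq ij)) mulrC.
ring.
Qed.

Let energyE f : dens f -> energy eta f = (\int[H2 R]_(p in S) ent (f p) (fld f p))%E.
Proof.
by move=> df; apply: eq_integral => p _; rewrite -mean_field_fld.
Qed.

Let density_prob f : dens f -> prob_density f.
Proof.
move=> df; split; first exact: density_integrable.
- by apply: aeW => p _; have [_ f0 _] := df.
- by have [] := df.
Qed.

(** The positive part of [f] differs from it on a null set only, so the two mean fields, being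
    integrals, agree at every point. *)
Let prob_density_density f : prob_density f ->
  exists2 g, dens g & energy eta g = energy eta f.
Proof.
move=> [intf f0 f1]; pose g p := Num.max (f p) 0.
have mf : measurable_fun S f by apply/measurable_EFinP; exact: measurable_int intf.
have mg : measurable_fun S g by exact: measurable_maxr.
have gf : {ae H2 R, forall p, S p -> g p = f p}.
  by move: f0; apply: filterS => p fp /fp; exact: max_l.
have mfE : measurable_fun S (EFin \o f) by exact/measurable_EFinP.
have mgE : measurable_fun S (EFin \o g) by exact/measurable_EFinP.
have dg : dens g.
  split; [exact: mg|by move=> p; rewrite le_max lexx orbT|].
  apply: etrans f1; apply: (ae_eq_integral _ _ mS mgE mfE).
  by move: gf; apply: filterS => p gp /gp /= ->.
have fieldE p : mean_field g p = mean_field f p.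
  have mk : measurable_fun S (fun q : space3 R => dot (p : 'rV[R]_3) q ^+ 2 - 1 / 3).
    apply: measurable_funTS; apply: measurable_funB; last exact: measurable_cst.
    by apply: measurable_funX; exact: measurable_dot.
  have mkf : measurable_fun S
      (fun q : space3 R => ((dot (p : 'rV[R]_3) q ^+ 2 - 1 / 3) * f q)%:E).
    by apply/measurable_EFinP; exact: (measurable_funM mk mf).
  have mkg : measurable_fun S
      (fun q : space3 R => ((dot (p : 'rV[R]_3) q ^+ 2 - 1 / 3) * g q)%:E).
    by apply/measurable_EFinP; exact: (measurable_funM mk mg).
  congr fine; apply: (ae_eq_integral _ _ mS mkg mkf).
  by move: gf; apply: filterS => q gq /gq /= ->.
exists g; first exact: dg.
have mfield : measurable_fun S (fun p => mean_field g p - eta).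
  rewrite (_ : (fun p => _) = fld g); first exact: measurable_potential.
  by apply/funext => p; exact: mean_field_fld.
have mIg := measurable_ent mg mfield; have mIf := measurable_ent mf mfield.
transitivity (\int[H2 R]_(p in S) ent (f p) (mean_field g p - eta))%E.
  apply: (ae_eq_integral _ _ mS mIg mIf).
  by move: gf; apply: filterS => p gp /gp /= ->.
by apply: eq_integral => p _; rewrite fieldE.
Qed.

(** The Cauchy-Schwarz inequality, from Lagrange's identity for the cross product. *)
Let dot_sqr_le1 p q : S p -> S q -> dot (p : 'rV[R]_3) q ^+ 2 <= 1.
Proof.
move=> Sp Sq; rewrite (dot3E _ _ 0).
have : dot (p : 'rV[R]_3) p = 1 := Sp; have : dot (q : 'rV[R]_3) q = 1 := Sq.
rewrite !(dot3E _ _ 0).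
set p0 := (p : 'rV[R]_3) 0 0; set p1 := (p : 'rV[R]_3) 0 (0 + 1).
set p2 := (p : 'rV[R]_3) 0 (0 + 2); set q0 := (q : 'rV[R]_3) 0 0.
set q1 := (q : 'rV[R]_3) 0 (0 + 1); set q2 := (q : 'rV[R]_3) 0 (0 + 2) => qq pp.
have -> : (p0 * q0 + p1 * q1 + p2 * q2) ^+ 2 =
    (p0 * p0 + p1 * p1 + p2 * p2) * (q0 * q0 + q1 * q1 + q2 * q2) -
    ((p0 * q1 - p1 * q0) ^+ 2 + (p0 * q2 - p2 * q0) ^+ 2 + (p1 * q2 - p2 * q1) ^+ 2).
  by ring.
by rewrite pp qq mulr1 gerBl !addr_ge0 ?sqr_ge0.
Qed.

Let kernel_integrable f p : dens f -> S p ->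
  (H2 R).-integrable S (fun q => ((dot (p : 'rV[R]_3) q ^+ 2 - 1 / 3) * f q)%:E).
Proof.
move=> df Sp; have [mf f0 _] := df.
apply: (le_integrable mS) (density_integrable df).
  apply/measurable_EFinP; apply: (measurable_funM _ mf); apply: measurable_funTS.
  apply: measurable_funB; last exact: measurable_cst.
  by apply: measurable_funX; exact: measurable_dot.
move=> q Sq; rewrite lee_fin normrM -[leRHS]mul1r ler_wpM2r// ler_norml.
by have := dot_sqr_le1 Sp Sq; have := sqr_ge0 (dot (p : 'rV[R]_3) q); lra.
Qed.

Let mean_field_le f p k : dens f -> S p ->
  (forall q, S q -> (dot (p : 'rV[R]_3) q ^+ 2 - 1 / 3) * f q <= k * f q) ->
  mean_field f p <= k.
Proof.
move=> df Sp fk; have [_ _ f1] := df; have intf := density_integrable df.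
have -> : k = \int[H2 R]_(q in S) (k * f q).
  by rewrite RintegralZl// /Rintegral f1 mulr1.
apply: le_Rintegral => //; first exact: kernel_integrable.
exact: (integrableZl mS k intf).
Qed.

(** The weight [f q] makes the hypothesis void where [f] vanishes, so a kernel bound on the patch
    alone suffices. *)
Let mean_field_ge f p k : dens f -> S p ->
  (forall q, S q -> k * f q <= (dot (p : 'rV[R]_3) q ^+ 2 - 1 / 3) * f q) ->
  k <= mean_field f p.
Proof.
move=> df Sp fk; have [_ _ f1] := df; have intf := density_integrable df.
have -> : k = \int[H2 R]_(q in S) (k * f q).
  by rewrite RintegralZl// /Rintegral f1 mulr1.
apply: le_Rintegral => //; last exact: kernel_integrable.
exact: (integrableZl mS k intf).
Qed.

Let energy_infinite f : 2 / 3 <= eta -> dens f -> energy eta f = +oo%E.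
Proof.
move=> eta23 df; rewrite energyE//.
apply: mean_field_energy_pinfty => // p Sp.
rewrite -[X in X <= _]mean_field_fld// subr_le0; apply: le_trans eta23.
apply: mean_field_le => // q Sq; have [_ f0 _] := df.
by rewrite ler_wpM2r//; have := dot_sqr_le1 Sp Sq; lra.
Qed.

(** All coordinates are nonnegative on the patch, so the dot product is at least the product of the
    third coordinates, whose squares are at least [1 - 2 r^2]. *)
Let dot_patch_ge r p q : 0 <= r <= 1 / 2 -> patch r p -> patch r q ->
  1 - 4 * r ^+ 2 <= dot (p : 'rV[R]_3) q ^+ 2.
Proof.
move=> /andP[r0 r12] [pp [/andP[p00 p0r] /andP[p10 p1r] p20]].
move=> [qq [/andP[q00 q0r] /andP[q10 q1r] q20]].
move: pp qq; rewrite !(dot3E _ _ 0) !add0r.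
move: ((p : 'rV[R]_3) 0 0) ((p : 'rV[R]_3) 0 1) ((p : 'rV[R]_3) 0 2)
  ((q : 'rV[R]_3) 0 0) ((q : 'rV[R]_3) 0 1) ((q : 'rV[R]_3) 0 2)
  p00 p0r p10 p1r p20 q00 q0r q10 q1r q20 => x y z x' y' z'.
move=> x0 xr y0 yr z0 x'0 x'r y'0 y'r z'0 xyz xyz'.
have sq (t : R) : 0 <= t -> t <= r -> t * t <= r * r by move=> ? ?; exact: ler_pM.
have r2 : 0 <= 1 - 2 * r ^+ 2 by nra.
have zz : 1 - 2 * r ^+ 2 <= z * z by have := sq _ x0 xr; have := sq _ y0 yr; lra.
have zz' : 1 - 2 * r ^+ 2 <= z' * z' by have := sq _ x'0 x'r; have := sq _ y'0 y'r; lra.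
have prod : (1 - 2 * r ^+ 2) ^+ 2 <= (z * z') ^+ 2.
  by rewrite [leLHS]expr2 exprMn !expr2; apply: ler_pM.
apply: (@le_trans _ _ ((1 - 2 * r ^+ 2) ^+ 2)).
  by have := sqr_ge0 (r ^+ 2); lra.
apply: le_trans prod _; rewrite ler_sqr ?nnegrE ?mulr_ge0//; last first.
  by rewrite !addr_ge0// mulr_ge0.
by rewrite lerDr addr_ge0// mulr_ge0.
Qed.

Let measurable_patch r : measurable (patch r : set (space3 R)).
Proof.
have ray i (x : R) : measurable [set p : space3 R | x <= (p : 'rV[R]_3) 0 i].
  rewrite (_ : [set p | _] = (fun p : space3 R => (p : 'rV[R]_3) 0 i) @^-1` `[x, +oo[).
    by rewrite -[_ @^-1` _]setTI; exact: measurable_coord.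
  by apply/seteqP; split => p /=; rewrite in_itv/= andbT.
have ray' i (x : R) : measurable [set p : space3 R | (p : 'rV[R]_3) 0 i <= x].
  rewrite (_ : [set p | _] = (fun p : space3 R => (p : 'rV[R]_3) 0 i) @^-1` `]-oo, x]).
    by rewrite -[_ @^-1` _]setTI; exact: measurable_coord.
  by apply/seteqP; split => p /=; rewrite in_itv.
rewrite (_ : patch r = S `&` (([set p | 0 <= p 0 0] `&` [set p | p 0 0 <= r]) `&`
  ([set p | 0 <= p 0 1] `&` [set p | p 0 1 <= r]) `&` [set p | 0 <= p 0 2])).
  exact: (measurableI _ _ mS (measurableI _ _ (measurableI _ _
    (measurableI _ _ (ray 0 0) (ray' 0 r)) (measurableI _ _ (ray 1 0) (ray' 1 r)))
    (ray 2 0))).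
apply/seteqP; split => p.
  by move=> [pp [/andP[? ?] /andP[? ?] ?]].
by move=> [pp [[[? ?] [? ?]] ?]]; split => //; split => //; apply/andP.
Qed.

Let finite_energy : eta < 2 / 3 -> exists2 f, dens f &
  (\int[H2 R]_(p in S) ent (f p) (fld f p) < +oo)%E.
Proof.
(* With [r = g / 4] and [g <= 1], the loss [4 r^2 = g^2 / 4] stays below [g <= 2 / 3 - eta], so
   [u > 0]. *)
move=> eta23; pose g := Num.min 1 (2 / 3 - eta); pose r := g / 4.
have g0 : 0 < g by rewrite lt_min ltr01 subr_gt0.
have g1 : g <= 1 by rewrite ge_min lexx.
have geta : g <= 2 / 3 - eta by rewrite ge_min lexx orbT.
have r12 : 0 < r <= 1 / 2 by rewrite /r; apply/andP; split; lra.
have P0 := hausdorff2_patch_gt0 r12.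
pose P : set (space3 R) := patch r.
have mP : measurable P by exact: measurable_patch.
have PS : P `<=` S by move=> p [].
have Pfin : H2 R P \is a fin_num.
  rewrite ge0_fin_numE; last exact: measure_ge0.
  apply: le_lt_trans S_lty; exact: (le_measure _ (mem_set mP) (mem_set mS) PS).
pose m := fine (H2 R P).
have mE : m%:E = H2 R P by rewrite /m fineK.
have m0 : 0 < m by rewrite -lte_fin mE.
pose f p := m^-1 * \1_P p.
have f_ge0 p : 0 <= f p by rewrite mulr_ge0// invr_ge0 ltW.
have df : dens f by exact: (density_uniform mS S_lty mP PS P0).
pose u := 2 / 3 - 4 * r ^+ 2 - eta.
have u0 : 0 < u by rewrite /u /r; have := mulr_ge0 (ltW g0) (ltW g0); nra.
exists f => //; apply: (@mean_field_energy_lty _ _ _ _ _ _ S_lty _ _ _ _ _ _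
  `|m^-1 * ln m^-1 - m^-1 * ln u|) => // p Sp.
have [Pp|Pp] := boolP (p \in P); last first.
  by rewrite [f p](_ : _ = 0) ?ent0 ?lee_fin// /f indicE (negbTE Pp) mulr0.
have fp : f p = m^-1 by rewrite /f indicE Pp mulr1.
apply: (@le_trans _ _ (ent (f p) u)); last first.
  by rewrite ent_gt0E// fp lee_fin ler_norm.
apply: ent_nincr => //; rewrite -[leRHS]mean_field_fld// /u lerD2r.
apply: mean_field_ge => // q Sq.
have [Pq|Pq] := boolP (q \in P); last first.
  by rewrite [f q](_ : _ = 0) ?mulr0// /f indicE (negbTE Pq) mulr0.
rewrite ler_wpM2r//; have r12' : 0 <= r <= 1 / 2 by have /andP[/ltW -> ->] := r12.
have := dot_patch_ge r12' (set_mem Pp) (set_mem Pq); lra.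
Qed.

Lemma energy_pinfty f : 2 / 3 <= eta -> prob_density f -> energy eta f = +oo%E.
Proof.
by move=> eta23 /prob_density_density[g dg <-]; exact: energy_infinite.
Qed.

Lemma minimiser_exists : eta < 2 / 3 ->
  exists fstar : space3 R -> R, [/\ prob_density fstar,
    (energy eta fstar < +oo)%E & forall f : space3 R -> R, prob_density f ->
      (energy eta fstar <= energy eta f)%E].
Proof.
move=> eta23.
have [g dg [gy gmin]] := mean_field_minimiser_exists mS S_lty measurable_quad
  quad_le1 (finite_energy eta23).
exists g; split; [exact: density_prob|by rewrite (energyE dg)|].
move=> f /prob_density_density[h dh <-].
by rewrite (energyE dg) (energyE dh); exact: (gmin h dh).
Qed.

End sphere_energy.

Theorem proposition2p5 (R : realType) (eta : R) :
  (exists fstar : space3 R -> R,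
    [/\ prob_density fstar,
        (energy eta fstar < +oo)%E &
        forall f : space3 R -> R, prob_density f ->
          (energy eta fstar <= energy eta f)%E])
  <-> eta < 2 / 3.
Proof.
split=> [[f [df fy _]]|]; last exact: minimiser_exists.
rewrite ltNge; apply/negP => eta23.
by rewrite (energy_pinfty eta23 df) ltxx in fy.
Qed.
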